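(* Let $\mathcal O$ be an elliptic conjugacy class of $\tilde W$ and let $\tilde w\in\mathcal O_{\min}$ be an element of minimal length in $\mathcal O$. Then the map $$\tau_{\tilde w}:\mathcal P_{\tilde w}\to W_{\tilde w},\qquad (i_1,\dots,i_t)\mapsto s_{i_1}\cdots s_{i_t}$$ is surjective.
   Context: $(W,S)$ is a finite Coxeter group with simple reflections $s_i$ ($i\in S$) and length function $\ell$; $\delta:W\to W$ is a group automorphism permuting the simple reflections; $\tilde W=\langle\delta\rangle\ltimes W$, with $\ell(\delta^k w)=\ell(w)$ for $k\in\mathbb Z$, $w\in W$. $V$ is a finite-dimensional real inner product space with an injective homomorphism $\tilde W\to GL(V)$ preserving the inner product, such that each $s_i$ acts as a reflection. A Weyl chamber is a connected component of the complement in $V$ of all reflecting hyperplanes of reflections in $W$. The fundamental chamber $C$ is the Weyl chamber whose walls are the reflecting hyperplanes of the $s_i$, $i\in S$, and $\delta(C)=C$. $V^W$ is the space of $W$-fixed vectors. A conjugacy class $\mathcal O$ of $\tilde W$ is elliptic if for some (equivalently any) $\tilde w\in\mathcal O$ every vector of $V$ fixed by $\tilde w$ lies in $V^W$. $\mathcal O_{\min}$ is the set of elements of minimal length in $\mathcal O$. For $\tilde w$ of minimal length in its conjugacy class: $\mathcal P_{\tilde w}$ is the set of finite sequences $(i_1,\dots,i_t)$ ($t\ge 0$) of elements of $S$ such that $\tilde w\xrightarrow{s_{i_1}} s_{i_1}\tilde w s_{i_1}\xrightarrow{s_{i_2}}\cdots\xrightarrow{s_{i_t}} s_{i_t}\cdots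 s_{i_1}\tilde w s_{i_1}\cdots s_{i_t}$, where $\tilde x\xrightarrow{s_i}\tilde x'$ means $\tilde x'=s_i\tilde x s_i$ and $\ell(\tilde x')\le\ell(\tilde x)$ (so by minimality all these elements have the same length as $\tilde w$). $W_{\tilde w}=\{w\in W:\ \ell(w^{-1}\tilde w w)=\ell(\tilde w)\}$. *)

(* Defs.v *)
From HB Require Import structures.
From mathcomp Require Import all_boot all_order all_fingroup all_algebra.
From mathcomp Require Import all_classical all_reals all_analysis.
From mathcomp Require Import sesquilinear.

Set Implicit Arguments.
Unset Strict Implicit.
Unset Printing Implicit Defensive.

Import GroupScope Order.TTheory GRing.Theory Num.Theory.
Import numFieldNormedType.Exports.

(* The last field says that W is presented by the Coxeter relations
   (s_i s_j)^(m i j) = 1, where m i j is the order of s_i s_j (m i i = 1). *)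
Record is_coxeter_system (W : finGroupType) (I : finType) (s : I -> W) : Prop :=
  IsCoxeterSystem {
    cox_inj : injective s;
    cox_order : forall i, #[s i] = 2;
    cox_gen : <<[set s i | i : I]>> = [set: W];
    cox_univ : forall (H : groupType) (f : I -> H),
      (forall i j, (f i * f j) ^+ #[s i * s j] = 1) ->
      exists phi : {multiplicative W -> H}, forall i, phi (s i) = f i
  }.

Record coxeterSystem := CoxeterSystem {
  cox_group :> finGroupType;
  cox_index : finType;
  srefl : cox_index -> cox_group;
  coxP : is_coxeter_system srefl
}.

Section Length.
Variable X : coxeterSystem.

Definition word_prod (t : seq (cox_index X)) : X := \prod_(i <- t) srefl i.

Lemma word_exists (w : X) :
  exists n, [exists t : n.-tuple (cox_index X), word_prod t == w].
Proof.
have: w \in <<[set srefl i | i : cox_index X]>> by rewrite (cox_gen (coxP X)) inE.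
case/gen_prodgP=> n [c Ac ->]; exists n.
have cP k : {i | c k == srefl i}.
  by apply: sigW; have /imsetP[i _ ->] := Ac k; exists i.
apply/existsP; exists [tuple sval (cP k) | k < n]; apply/eqP.
rewrite /word_prod big_tuple; apply: eq_bigr => k _.
by rewrite tnth_mktuple; case: (cP k) => i /= /eqP.
Qed.

Definition cox_length (w : X) : nat := ex_minn (word_exists w).

End Length.

Record diagramAut (X : coxeterSystem) := DiagramAut {
  dg_perm : {perm X};
  dg_aut : dg_perm \in Aut [set: X];
  dg_simple : forall i, exists j, dg_perm (@srefl X i) = srefl j
}.

Section Twisted.
Variables (X : coxeterSystem) (D : diagramAut X).

Lemma dg_cycle_sub : <[dg_perm D]> \subset Aut [set: X].
Proof. by rewrite cycle_subG dg_aut. Qed.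

(* The elements are the pairs (a, x) with a in <delta> and x in W;
   such a pair is the product a * x. *)
Definition twisted_group : finGroupType :=
  sdprod_groupType ([Aut [set: X]] \ dg_cycle_sub)%gact.

Definition tw_of (w : X) : twisted_group := sdpair1 _ w.

(* MathComp groups act on the right, so that a^-1 * x * a = a x in
   sdprod_groupType; this inverse gives delta * x * delta^-1 = delta x. *)
Definition tw_delta : twisted_group := sdpair2 _ (dg_perm D)^-1.

Definition tw_length (g : twisted_group) : nat := cox_length g.2.

Lemma tw_ofM (v w : X) : tw_of (v * w) = tw_of v * tw_of w.
Proof. by rewrite /tw_of sdpair1_morphM ?inE. Qed.

Lemma tw_of_inj : injective tw_of.
Proof.
by move=> v w; apply: (injmP (injm_sdpair1 _)); rewrite inE.
Qed.

Lemma tw_deltaJ (w : X) :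
  tw_delta * tw_of w * tw_delta^-1 = tw_of (dg_perm D w).
Proof.
have dD : dg_perm D \in <[dg_perm D]> by exact: cycle_id.
rewrite /tw_delta /tw_of (_ : _ (dg_perm D)^-1 =
  (sdpair2 ([Aut [set: X]] \ dg_cycle_sub)%gact (dg_perm D))^-1).
  by rewrite invgK -mulgA -conjgE -sdpair_act ?inE.
by rewrite -(morphV (sdpair2_morphism _)).
Qed.

Lemma tw_length_delta k (w : X) :
  tw_length (tw_delta ^+ k * tw_of w) = cox_length w.
Proof.
have dD : (dg_perm D)^-1 \in <[dg_perm D]> by rewrite groupV cycle_id.
rewrite /tw_delta -(morphX (sdpair2_morphism _)) //.
rewrite /tw_length /tw_of /= /sdpair1 /sdpair2 !val_insubd !inE /=.
by rewrite groupX // group1 /= act1 ?inE //= mul1g.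
Qed.

Lemma tw_decomp (g : twisted_group) :
  exists k (w : X), g = tw_delta ^+ k * tw_of w.
Proof.
have := sdpairE g; case: g => [[a x] ax] /= ->; move: (ax) => /setXP[aD _].
have: a \in <[(dg_perm D)^-1]> by rewrite cycleV.
case/cycleP=> k ->; exists k, x; congr (_ * _).
by rewrite -(morphX (sdpair2_morphism _)) // groupV cycle_id.
Qed.

Definition min_elements (O : {set twisted_group}) : {set twisted_group} :=
  [set g in O | [forall h in O, tw_length g <= tw_length h]].

Fixpoint weak_descent (g : twisted_group) (t : seq (cox_index X)) : bool :=
  if t is i :: t' then
    let g' := tw_of (srefl i) * g * tw_of (srefl i) in
    (tw_length g' <= tw_length g) && weak_descent g' t'
  else true.

Definition path_set (g : twisted_group) : set (seq (cox_index X)) :=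
  [set t | weak_descent g t].

Definition length_stabilizer (g : twisted_group) : set X :=
  [set w | tw_length ((tw_of w)^-1 * g * tw_of w) = tw_length g].

End Twisted.

Local Open Scope classical_set_scope.
Local Open Scope ring_scope.

Section Geometry.
Variables (R : realType) (V : vectType R) (dot : {dot V for idfun}).

(* The canonical topology of the finite-dimensional real space V,
   transported from R^n by coordinates in a basis. *)
Definition euclid : topologicalType := initial_topology (passmx.rVof (vbasis {:V})).

Definition is_reflection (f : 'End(V)) : Prop :=
  exists2 a : V, a != 0 &
    forall v, f v = v - (2 * dot v a / dot a a) *: a.

Variables (X : coxeterSystem) (D : diagramAut X).

Record is_orthogonal_rep (rho : twisted_group D -> 'End(V)) : Prop :=
  IsOrthogonalRep {
    rep1 : rho 1%g = \1%VF;
    repM : forall g h, rho (g * h)%g = (rho g \o rho h)%VF;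
    rep_inj : injective rho;
    rep_dot : forall g u v, dot (rho g u) (rho g v) = dot u v
  }.

Variable rho : twisted_group D -> 'End(V).

Definition reflecting_hyperplane (H : {vspace V}) : Prop :=
  exists2 w : X, is_reflection (rho (tw_of D w)) &
    H = fixedSpace (rho (tw_of D w)).

Definition hyperplane_complement : set euclid :=
  [set v | forall H, reflecting_hyperplane H -> (v : V) \notin H].

Definition weyl_chamber (C : set euclid) : Prop :=
  exists2 v, hyperplane_complement v &
    C = connected_component hyperplane_complement v.

(* The closure of C meets H in a set spanning H. *)
Definition wall (C : set euclid) (H : {vspace V}) : Prop :=
  reflecting_hyperplane H /\
  forall U : {vspace V},
    (forall v : V, v \in H -> closure C v -> v \in U) -> (H <= U)%VS.

Definition fundamental_chamber (C : set euclid) : Prop :=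
  [/\ weyl_chamber C,
      forall H, wall C H <->
        exists i, H = fixedSpace (rho (tw_of D (@srefl X i)))
    & rho (tw_delta D) @` C = C].

Definition fixed_by_W : {vspace V} :=
  (\bigcap_(w : X) fixedSpace (rho (tw_of D w)))%VS.

Definition elliptic (O : {set twisted_group D}) : Prop :=
  exists2 g, g \in O & (fixedSpace (rho g) <= fixed_by_W)%VS.

End Geometry.

(* Main.v *)
(** Write f(A) for the number of reflecting hyperplanes separating a Weyl chamber A
    from g A; then f(x C) is the length of x^-1 g x, and a path in the statement is a
    gallery from C along which f never increases.  Crossing a wall with normal a
    at a point v increases f only if (g v, a) and (g^-1 v, a) both point
    backwards, so f does not increase along galleries following the vector
    fields g v, g^-1 v and M v, where M = g + g^-1.  It is enough to show that the
    sets A and B of chambers reachable from two given chambers always meet: for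
    chambers of minimal f, the gallery of the second can then be reversed.

    Let F be the top eigenspace of M on the span of the normals.  If g is not -1
    there, ellipticity makes g act on F as a rotation by an angle strictly
    between 0 and pi.  Take unit vectors p, q in the closures of A and B with q in F
    and (p, q) maximal.  The flow of M forces p into F, and a small simultaneous
    rotation makes the set of hyperplanes through p stable under g.  If p = q, one
    concludes by induction for the arrangement of hyperplanes through p.
    If not, the induction hypothesis applied to the germ of A at p and to its
    negative yields directions eta and -eta both leading from p into A, one of
    which increases (p, q).  If g is -1, all hyperplanes are g-stable and every
    wall can be crossed. *)

Require Import Defs.
From mathcomp Require Import all_boot all_order all_fingroup all_algebra.
From mathcomp Require Import all_classical all_reals all_analysis.
From mathcomp Require Import sesquilinear ring lra.

Set Implicit Arguments.
Unset Strict Implicit.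
Unset Printing Implicit Defensive.

Import GroupScope Order.TTheory GRing.Theory Num.Theory.
Import numFieldNormedType.Exports.

Local Open Scope classical_set_scope.
Local Open Scope ring_scope.

(** * Topology and extrema in a Euclidean space *)

Section InnerProduct.
Variables (R : realType) (V : vectType R) (dot : {dot V for idfun}).
Implicit Types (u v w : V) (c : R).

Lemma dotC u v : dot u v = dot v u.
Proof. by rewrite hermC /= expr0 mul1r. Qed.

Lemma dotDr u v w : dot u (v + w) = dot u v + dot u w.
Proof. exact: linearDr. Qed.
Lemma dotDl u v w : dot (v + w) u = dot v u + dot w u.
Proof. by rewrite dotC dotDr ![dot u _]dotC. Qed.
Lemma dotZr c u v : dot u (c *: v) = c * dot u v.
Proof. by rewrite linearZr_LR. Qed.
Lemma dotZl c u v : dot (c *: v) u = c * dot v u.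
Proof. by rewrite dotC dotZr dotC. Qed.
Lemma dotNr u v : dot u (- v) = - dot u v.
Proof. by rewrite -scaleN1r dotZr mulN1r. Qed.
Lemma dotNl u v : dot (- v) u = - dot v u.
Proof. by rewrite dotC dotNr dotC. Qed.
Lemma dot0r u : dot u 0 = 0.
Proof. by rewrite -(scale0r 0) dotZr mul0r. Qed.
Lemma dot0l u : dot 0 u = 0.
Proof. by rewrite dotC dot0r. Qed.
Lemma dot_gt0 u : u != 0 -> 0 < dot u u.
Proof. exact: neq0_dnorm_gt0. Qed.
Lemma dot_ge0 u : 0 <= dot u u.
Proof. by have [->|/dot_gt0/ltW//] := eqVneq u 0; rewrite dot0r. Qed.
Lemma dot_eq0 u : (dot u u == 0) = (u == 0).
Proof. by have [->|/dot_gt0/gt_eqF//] := eqVneq u 0; rewrite dot0r eqxx. Qed.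

Definition dotE := (dotDl, dotDr, dotZl, dotZr, dotNl, dotNr, dot0l, dot0r).

End InnerProduct.

Section EuclidTopology.
Variables (R : realType) (V : vectType R).
Local Notation E := (euclid V).
Local Notation co := (passmx.rVof (vbasis {:V})).
Local Notation oc := (passmx.vecof (vbasis {:V})).

Lemma rVof_vbasisK : cancel co oc.
Proof. exact: passmx.rVofK (vbasisP _). Qed.
Lemma vecof_vbasisK : cancel oc co.
Proof. exact: passmx.vecofK (vbasisP _). Qed.

Lemma rVof_vbasisZ c v : co (c *: v) = c *: co v.
Proof. by apply/rowP => i; rewrite !mxE linearZ. Qed.
Lemma rVof_vbasis0 : co 0 = 0.
Proof. by apply/rowP => i; rewrite !mxE linear0. Qed.

Lemma coord_euclid_continuous i : continuous (fun v : E => co v 0 i).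
Proof.
move=> v.
apply: (@continuous_comp _ _ _ (co : E -> _) (fun x : 'rV_ _ => x 0 i)).
  exact: initial_continuous.
exact: coord_continuous.
Qed.

Lemma linear_euclid_continuous (f : {linear V -> R^o}) :
  continuous (f : E -> R).
Proof.
have -> : (f : E -> R) =
    fun v : E => \sum_i co v 0 i * f (vbasis {:V})`_i.
  apply/funext => v; rewrite {1}(coord_vbasis (memvf (v : V))) linear_sum.
  by apply: eq_bigr => i _; rewrite linearZ /= passmx.coord_rVof.
apply: continuous_big => [|i _]; first exact: (@add_continuous R^o).
move=> v; apply: cvgMr_tmp; first exact: (@nbhs_filter E).
exact: coord_euclid_continuous.
Qed.

Lemma vecof_vbasis_continuous : continuous (oc : 'rV_(\dim {:V}) -> E).
Proof.
apply/continuousP => A [B oB <-]; rewrite -comp_preimage.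
have -> : co \o (oc : _ -> E) = id by apply/funext => x /=; rewrite vecof_vbasisK.
by [].
Qed.


(** The unit sphere of the maximum norm on coordinates. It serves only as a compact set meeting
    every ray from 0, so the inner product does not enter. *)
Definition box_sphere : set E := [set v | `|co v| = 1].

Lemma box_sphere_compact : compact box_sphere.
Proof.
have -> : box_sphere = oc @` [set x : 'rV_(\dim {:V}) | `|x| = 1].
  apply/seteqP; split=> [v /= v1|_ [x /= x1 <-]].
    by exists (co v) => //; rewrite rVof_vbasisK.
  by rewrite /box_sphere /= vecof_vbasisK.
apply: continuous_compact; first exact/continuous_subspaceT/vecof_vbasis_continuous.
apply: bounded_closed_compact.
  by exists 1; split=> // M M1 x /= ->; exact: ltW.
have -> : [set x : 'rV[R]_(\dim {:V}) | `|x| = 1] = Num.norm @^-1` [set 1].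
  by [].
by apply: closed_comp (@closed_eq R 1) => x _; exact: norm_continuous.
Qed.

Lemma box_sphere_scale (v : V) : v != 0 ->
  exists2 c : R, 0 < c & box_sphere (c *: v).
Proof.
move=> v0; have cv : 0 < `|co v|.
  by rewrite normr_gt0 passmx.rVof_eq0 ?vbasisP.
exists `|co v|^-1; first by rewrite invr_gt0.
rewrite /box_sphere /= rVof_vbasisZ normrZ ger0_norm ?invr_ge0 ?ltW//.
by rewrite mulVf// gt_eqF.
Qed.

Lemma box_sphere_neq0 v : box_sphere v -> (v : V) != 0.
Proof.
by rewrite /box_sphere /=; apply: contraPneq => ->; rewrite rVof_vbasis0 normr0 =>
  /esym/eqP; rewrite oner_eq0.
Qed.

Definition cone (K : set V) := forall c v, 0 < c -> K v -> K (c *: v).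

(** A function constant on pairs of rays is determined on the compact product of the two cones with
    [box_sphere], where it attains its maximum. *)
Lemma cone_pair_max (K L : set E) (f : E * E -> R) (k l : V) :
  closed K -> closed L -> cone K -> cone L ->
  K k -> k != 0 -> L l -> l != 0 ->
  (forall x y : V, x != 0 -> y != 0 -> {for (x, y), continuous f}) ->
  (forall a b (x y : V), 0 < a -> 0 < b -> f (a *: x, b *: y) = f (x, y)) ->
  exists x y : V, [/\ K x, x != 0, L y, y != 0 &
    forall x' y' : V, K x' -> x' != 0 -> L y' -> y' != 0 ->
    f (x', y') <= f (x, y)].
Proof.
move=> cK cL coneK coneL Kk k0 Ll l0 fC fH.
have cKL : compact ((K `&` box_sphere) `*` (L `&` box_sphere)).
  by apply: compact_setX; rewrite setIC; apply: compact_closedI => //;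
    exact: box_sphere_compact.
have [a a0 sk] := box_sphere_scale k0; have [b b0 sl] := box_sphere_scale l0.
have fW : {within (K `&` box_sphere) `*` (L `&` box_sphere), continuous f}.
  apply: continuous_in_subspaceT => -[x y]; rewrite inE => -[[_ sx] [_ sy]].
  by apply: fC; exact: box_sphere_neq0.
have [|[x y]] := compact_EVT_max _ cKL fW.
  by exists (a *: k, b *: l); split; split=> //=;
    [exact: coneK|exact: coneL].
rewrite inE => -[[/= Kx sx] [Ly sy]] xy.
exists x, y; split=> //; try exact: box_sphere_neq0.
move=> x' y' Kx' x0 Ly' y0.
have [c c0 sx'] := box_sphere_scale x0; have [d d0 sy'] := box_sphere_scale y0.
rewrite -(fH c d)//; apply: xy; rewrite inE; split; split=> //=.
  exact: coneK.
exact: coneL.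
Qed.

Variable (dot : {dot V for idfun}).

(** Joint continuity: once the first argument is expanded in coordinates, each summand is a product
    of two continuous linear forms. The map [f] covers both norms and quadratic forms. *)
Lemma cvg_dot (T : Type) (F : set_system T) (FF : Filter F)
    (f : {linear V -> V}) (x y : T -> E) (a b : E) :
  x @ F --> a -> y @ F --> b ->
  dot (f (x t)) (y t) @[t --> F] --> dot (f a) b.
Proof.
move=> xa yb.
have E0 v w : dot (f v) w =
    \sum_i co v 0 i * dot (f (vbasis {:V})`_i) w.
  rewrite {1}(coord_vbasis (memvf v)) linear_sum linear_sumlz /=.
  apply: eq_bigr => i _; rewrite linearZ /= dotZl.
  by rewrite passmx.coord_rVof.
rewrite E0; under eq_cvg do rewrite E0.
apply: cvg_big => [|i _]; first exact: (@add_continuous R^o).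
apply: cvgM.
  apply: (@cvg_comp _ _ _ x (fun v : E => co v 0 i) _ _ _ xa).
  exact: (@coord_euclid_continuous i a).
set u := f _.
apply: (@cvg_comp _ _ _ y (fun v : E => dot u v) _ _ _ yb).
exact: (@linear_euclid_continuous (dot u)).
Qed.

Lemma dotl_continuous (f : {linear V -> V}) (a : V) :
  continuous (fun v : E => dot (f v) a).
Proof.
move=> v; have FF : Filter (nbhs (v : E)) by exact: nbhs_filter.
exact: (@cvg_dot _ _ FF f id (fun=> a) v a cvg_id (cvg_cst _)).
Qed.

End EuclidTopology.

(** * One-sided germs at 0 and first-order conditions *)

Section Small.
Variable R : realType.
Implicit Types P Q : R -> Prop.

(** Such germs are stable under finite conjunction, so one perturbation parameter can meet several
    requirements at once. *)
Definition small P := exists2 e0 : R, 0 < e0 & forall e, 0 < e < e0 -> P e.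

Lemma small_ex P : small P -> exists2 e, 0 < e & P e.
Proof.
by case=> e0 e0_gt0 Pe; exists (e0 / 2); [lra|apply: Pe; apply/andP; split; lra].
Qed.

Lemma small_and P Q : small P -> small Q -> small (fun e => P e /\ Q e).
Proof.
move=> [e1 e1_gt0 Pe] [e2 e2_gt0 Qe]; exists (Num.min e1 e2).
  by rewrite lt_min e1_gt0.
move=> e /andP[e_gt0]; rewrite lt_min => /andP[? ?].
by split; [apply: Pe|apply: Qe]; apply/andP.
Qed.

Lemma small_sub P Q : (forall e, 0 < e -> P e -> Q e) -> small P -> small Q.
Proof.
move=> PQ [e0 e0_gt0 Pe]; exists e0 => // e /andP[e_gt0 ee0].
by apply: PQ => //; apply: Pe; rewrite e_gt0.
Qed.

Lemma small_all (T : eqType) (s : seq T) (P : T -> R -> Prop) :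
  (forall a, a \in s -> small (P a)) -> small (fun e => forall a, a \in s -> P a e).
Proof.
elim: s => [|b s IHs] Ps; first by exists 1.
have [||e0 e0_gt0 Pe] := @small_and (P b) (fun e => forall a, a \in s -> P a e).
- by apply: Ps; rewrite mem_head.
- by apply: IHs => a sa; apply: Ps; rewrite inE sa orbT.
exists e0 => // e /Pe[Pb Ps'] a; rewrite inE => /orP[/eqP->//|]; exact: Ps'.
Qed.

Lemma small_affine (x y : R) : 0 < x -> small (fun e => 0 < x + e * y).
Proof.
move=> x_gt0; have y1 : 0 < 1 + `|y| by rewrite ltr_wpDr.
exists (x / (1 + `|y|)); first by rewrite divr_gt0.
move=> e /andP[e_gt0]; rewrite ltr_pdivlMr// => ex.
by have : - `|y| <= y by [rewrite lerNl ler_normr lexx orbT]; nra.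
Qed.

Lemma le_small (x y z : R) : small (fun e => x <= y + e * z) -> x <= y.
Proof.
move=> sm; rewrite leNgt; apply/negP => yx.
have := small_affine (- z) (_ : 0 < x - y); rewrite subr_gt0 => /(_ yx) sm'.
by have [e e_gt0 [? ?]] := small_ex (small_and sm sm'); lra.
Qed.

Lemma mulr_gt0_trans (x y z : R) : 0 < x * y -> 0 < y * z -> 0 < x * z.
Proof.
move=> xy yz; have := mulr_gt0 xy yz.
rewrite (_ : x * y * (y * z) = x * z * y ^+ 2); last by ring.
by rewrite pmulr_lgt0// exprn_even_gt0 //=; apply: contraTneq xy => ->; rewrite mulr0 ltxx.
Qed.

(* Compares the right derivatives at e = 0 of the two sides. *)
Lemma le_sqrt_small (m d b c : R) :
  small (fun e => m + e * d <= m * Num.sqrt (1 + 2 * e * b + e ^+ 2 * c)) ->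
  d <= m * b.
Proof.
move=> sm; apply: (@le_small _ _ (2 * (`|m| * `|c - b ^+ 2|))).
have half_gt0 : 0 < 1 / 2 :> R by lra.
have sm1 := small_affine b half_gt0.
have sm2 : small (fun e => 0 < 1 + e * (2 * b - `|c|)) by exact: small_affine ltr01.
have sm3 : small (fun e => 0 < 1 + e * (-1)) by exact: small_affine ltr01.
apply: small_sub (small_and sm (small_and sm1 (small_and sm2 sm3))).
move=> e e_gt0 [le_m [b_gt0 [bc_gt0 e_lt1]]].
have N_ge0 : 0 <= 1 + 2 * e * b + e ^+ 2 * c.
  have c_ge : 0 <= c + `|c| by rewrite -lerBlDr sub0r lerNl ler_normr lexx orbT.
  have e1_gt0 : 0 < 1 - e by lra.
  have := mulr_ge0 (ltW (mulr_gt0 e_gt0 e1_gt0)) (normr_ge0 c).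
  have := mulr_ge0 (sqr_ge0 e) c_ge.
  by nra.
set s := Num.sqrt _ in le_m.
have s_ge0 : 0 <= s by exact: sqrtr_ge0.
have s2 : s ^+ 2 = 1 + 2 * e * b + e ^+ 2 * c by rewrite sqr_sqrtr.
have sE : (s - (1 + e * b)) * (s + (1 + e * b)) = e ^+ 2 * (c - b ^+ 2).
  by rewrite -subr_sqr s2; ring.
(* The lower bound on this factor turns the difference of squares into an error of order e^2 for the
   square root. *)
have s1 : 1 / 2 <= s + (1 + e * b) by lra.
have /= sN : `|s - (1 + e * b)| * (s + (1 + e * b)) = e ^+ 2 * `|c - b ^+ 2|.
  rewrite -[X in _ * X]ger0_norm; last by lra.
  by rewrite -normrM sE normrM ger0_norm ?sqr_ge0.
have sb : `|s - (1 + e * b)| <= 2 * (e ^+ 2 * `|c - b ^+ 2|).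
  by rewrite -sN; have := normr_ge0 (s - (1 + e * b)); nra.
have ms : m * (s - (1 + e * b)) <= `|m| * (2 * (e ^+ 2 * `|c - b ^+ 2|)).
  apply: le_trans (ler_norm _) _; rewrite normrM.
  by apply: ler_wpM2l.
rewrite -(ler_pM2l e_gt0).
by move: le_m ms; rewrite mulrBr; nra.
Qed.

End Small.

(** * Maximal cosines and Rayleigh quotients *)

Section Extrema.
Variables (R : realType) (V : vectType R) (dot : {dot V for idfun}).
Local Notation E := (euclid V).

Lemma near_dot_sign (s : seq V) (p : V) :
  \forall q \near (p : E), forall a, a \in s -> dot p a != 0 ->
    0 < dot p a * dot (q : V) a.
Proof.
elim: s => [|b s IHs]; first exact: filterE.
have cb : (fun q : E => dot p b * dot (q : V) b) @ (p : E) --> dot p b * dot p b.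
  apply: cvgMl_tmp; first exact: (@nbhs_filter E).
  exact: (@dotl_continuous _ _ dot idfun b p).
have [pb|pb] := eqVneq (dot p b) 0.
  by apply: filterS IHs => q qs a; rewrite inE => /orP[/eqP->|/qs//]; rewrite pb eqxx.
have pb2 : 0 < dot p b * dot p b by rewrite -expr2 exprn_even_gt0.
have := cb _ (open_nbhs_nbhs (conj (@open_gt R 0) pb2)) => {}cb.
apply: filterS (filterI IHs cb) => q [qs qb] a; rewrite inE => /orP[/eqP->//|/qs].
exact.
Qed.

Lemma closed_lin (f : {linear V -> V}) (a : V) :
  closed [set v : E | dot (f v) a = 0].
Proof.
apply: (@closed_comp _ _ (fun v : E => dot (f v) a) [set 0]); last exact: closed_eq.
by move=> v _; exact: dotl_continuous.
Qed.

Lemma closed_vspace (W : {vspace V}) : closed [set v : E | (v : V) \in W].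
Proof.
pose f := (\1 - projv W)%VF.
have -> : [set v : E | (v : V) \in W] = \bigcap_(a : V) [set v : E | dot (f v) a = 0].
  apply/seteqP; split=> [v /= vW a _ /=|v /= fv].
    by rewrite add_lfunE opp_lfunE id_lfunE projv_id// subrr dot0l.
  have := fv (f v) I => /eqP /=; rewrite dot_eq0 add_lfunE opp_lfunE id_lfunE.
  by rewrite subr_eq0 => /eqP ->; exact: memv_proj.
by apply: closed_bigI => a _; exact: closed_lin.
Qed.

Lemma dot_sqrt_gt0 (v : V) : v != 0 -> 0 < Num.sqrt (dot v v).
Proof. by move=> v0; rewrite sqrtr_gt0 dot_gt0. Qed.

Lemma dot_sqrtZ c (v : V) : 0 < c ->
  Num.sqrt (dot (c *: v) (c *: v)) = c * Num.sqrt (dot v v).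
Proof.
move=> c0; rewrite dotZl dotZr mulrA -expr2 sqrtrM ?sqr_ge0// sqrtr_sqr.
by rewrite gtr0_norm.
Qed.

(** Maximizes the cosine of the angle between the two cones. The homogeneous form of the bound also
    covers zero vectors, where the quotient is meaningless. *)
Lemma dot_pair_max (K L : set E) (k l : V) :
  closed K -> closed L -> cone K -> cone L ->
  K k -> k != 0 -> L l -> l != 0 ->
  exists x y : V, [/\ K x, dot x x = 1, L y, dot y y = 1 &
    forall x' y' : V, K x' -> L y' ->
    dot x' y' <= dot x y * (Num.sqrt (dot x' x') * Num.sqrt (dot y' y'))].
Proof.
move=> cK cL coneK coneL Kk k0 Ll l0.
pose f (z : E * E) := dot z.1 z.2 / (Num.sqrt (dot z.1 z.1) * Num.sqrt (dot z.2 z.2)).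
have fH a b (x y : V) : 0 < a -> 0 < b -> f (a *: x, b *: y) = f (x, y).
  move=> a0 b0; rewrite /f /= !dot_sqrtZ// !dotE.
  have [->|x0] := eqVneq x 0; first by rewrite !dotE; ring.
  have [->|y0] := eqVneq y 0; first by rewrite !dotE; ring.
  by have := dot_sqrt_gt0 x0; have := dot_sqrt_gt0 y0 => ? ?; field; lra.
have fC (x y : V) : x != 0 -> y != 0 -> {for (x : E, y : E), continuous f}.
  move=> x0 y0; have FF : Filter (nbhs ((x : E), (y : E))) by exact: nbhs_filter.
  apply: cvgM.
    exact: (@cvg_dot _ _ dot _ _ FF idfun fst snd x y cvg_fst cvg_snd).
  apply: cvgV; first by rewrite mulf_neq0 ?gt_eqF ?dot_sqrt_gt0.
  apply: cvgM.
    apply: (@continuous_cvg _ _ _ _ _ _ (@Num.sqrt R)); first exact: sqrt_continuous.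
    exact: (@cvg_dot _ _ dot _ _ FF idfun fst fst x x cvg_fst cvg_fst).
  apply: (@continuous_cvg _ _ _ _ _ _ (@Num.sqrt R)); first exact: sqrt_continuous.
  exact: (@cvg_dot _ _ dot _ _ FF idfun snd snd y y cvg_snd cvg_snd).
have [x [y [Kx x0 Ly y0 xy]]] := cone_pair_max cK cL coneK coneL Kk k0 Ll l0 fC fH.
have sx := dot_sqrt_gt0 x0; have sy := dot_sqrt_gt0 y0.
have nrm (v : V) : v != 0 -> dot ((Num.sqrt (dot v v))^-1 *: v) ((Num.sqrt (dot v v))^-1 *: v) = 1.
  move=> v0; have := dot_sqrt_gt0 v0 => s; rewrite !dotE -[X in _ * (_ * X)]sqr_sqrtr ?dot_ge0//.
  by field; lra.
exists ((Num.sqrt (dot x x))^-1 *: x), ((Num.sqrt (dot y y))^-1 *: y).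
split; rewrite ?nrm//.
- by apply: coneK => //; rewrite invr_gt0.
- by apply: coneL => //; rewrite invr_gt0.
move=> x' y' Kx' Ly'.
have [->|x'0] := eqVneq x' 0; first by rewrite !dotE sqrtr0 mul0r mulr0.
have [->|y'0] := eqVneq y' 0; first by rewrite !dotE sqrtr0 !mulr0.
have sx' := dot_sqrt_gt0 x'0; have sy' := dot_sqrt_gt0 y'0.
have := xy _ _ Kx' x'0 Ly' y'0; rewrite /f /= ler_pdivrMr ?mulr_gt0//.
move=> xy'; apply: le_trans xy' _; rewrite ler_pM2r ?mulr_gt0// !dotE.
by rewrite le_eqVlt; apply/orP; left; apply/eqP; field; lra.
Qed.

(** Maximizes the Rayleigh quotient on [W]; the second cone of [cone_pair_max] is a dummy. That the
    maximizer is an eigenvector is shown in [top_eigenvector]. *)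
Lemma top_eigenvalue (S : {linear V -> V}) (W : {vspace V}) (w : V) :
  w \in W -> w != 0 ->
  exists lam, exists x : V, [/\ x \in W, x != 0, dot (S x) x = lam * dot x x &
    forall y, y \in W -> dot (S y) y <= lam * dot y y].
Proof.
move=> Ww w0.
pose f (z : E * E) := dot (S z.1) z.1 / dot z.1 z.1.
have fH a b (x y : V) : 0 < a -> 0 < b -> f (a *: x, b *: y) = f (x, y).
  move=> a0 b0; have SZ : S (a *: x) = a *: S x by rewrite linearZ.
  rewrite /f /= SZ !dotE.
  have [->|/(dot_gt0 dot) x0] := eqVneq x 0; first by rewrite linear0 !dotE !mulr0 !mul0r.
  by field; lra.
have fC (x y : V) : x != 0 -> y != 0 -> {for (x : E, y : E), continuous f}.
  move=> x0 y0; have FF : Filter (nbhs ((x : E), (y : E))) by exact: nbhs_filter.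
  apply: cvgM; first exact: (@cvg_dot _ _ dot _ _ FF S fst fst x x cvg_fst cvg_fst).
  apply: cvgV; first by rewrite dot_eq0.
  exact: (@cvg_dot _ _ dot _ _ FF idfun fst fst x x cvg_fst cvg_fst).
have cW : cone [set v : E | (v : V) \in W] by move=> c v _ /= vW; exact: memvZ.
have [x [y [Wx x0 Wy y0 xy]]] := cone_pair_max (@closed_vspace W) (@closed_vspace W) cW cW Ww w0 Ww w0 fC fH.
exists (f (x, x)), x; split=> //.
  by rewrite /f /= mulfVK// dot_eq0.
move=> z Wz; have [->|z0] := eqVneq z 0; first by rewrite linear0 !dotE mulr0.
by have := xy z y Wz z0 Wy y0; rewrite {1}/f /= ler_pdivrMr ?dot_gt0.
Qed.

End Extrema.

(** * Families of cells closed under descending wall crossings *)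

Section Families.
Variables (R : realType) (V : vectType R) (dot : {dot V for idfun}).
Variables g g' : 'End(V).
Implicit Types (Phi : seq V) (A B : V -> Prop) (p q v : V).

Definition generic Phi v := forall a, a \in Phi -> dot v a != 0.

(* p lies in the closures of the cells of v and v'.  Crossing a wall a at p
   towards g p or g^-1 p, or crossing a wall stable under g, does not increase
   the number of hyperplanes between a chamber and its image under g. *)
Definition move_closed Phi A := forall p v v',
  A v -> generic Phi v' ->
  (forall a, a \in Phi -> dot p a != 0 ->
     0 < dot p a * dot v a /\ 0 < dot p a * dot v' a) ->
  (forall a, a \in Phi -> dot v a * dot v' a < 0 ->
     [\/ 0 < dot v' a * dot (g p) a, 0 < dot v' a * dot (g' p) a | g a = - a]) ->
  A v'.

Record flow_family Phi A : Prop := Family {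
  fam_gen : forall v, A v -> generic Phi v;
  fam_move : move_closed Phi A
}.

(** The closure of a cell is cut out by the weak sign conditions, so this is the union of the
    closures of the cells in [A]. *)
Definition cell_closure Phi A p :=
  exists2 v, A v & forall a, a \in Phi -> 0 <= dot p a * dot v a.

Definition localize Phi p := [seq a <- Phi | dot p a == 0].

(* The cells of the arrangement localize Phi p that, seen from p, belong to A. *)
Definition local_family Phi A p (eta : V) := generic (localize Phi p) eta /\
  exists2 v, A v & forall a, a \in Phi ->
    if dot p a != 0 then 0 < dot p a * dot v a else 0 < dot v a * dot eta a.

Lemma sqr_gt0 (x : R) : x != 0 -> 0 < x * x.
Proof. by move=> x0; rewrite -expr2 exprn_even_gt0. Qed.

Lemma mulr_gt0_neq0 (x y : R) : 0 < x * y -> x != 0 /\ y != 0.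
Proof. by move=> xy; split; apply: contraTneq xy => ->; rewrite ?mulr0 ?mul0r ltxx. Qed.

Lemma small_sign Phi p v : small (fun e => forall a, a \in Phi ->
  dot p a != 0 -> 0 < dot p a * dot (p + e *: v) a).
Proof.
apply: small_all => a _; have [pa|pa] := eqVneq (dot p a) 0.
  by exists 1 => // e _; rewrite eqxx.
have := small_affine (dot p a * dot v a) (sqr_gt0 pa).
by apply: small_sub => e _ h _; rewrite !dotE mulrDr [dot p a * (e * _)]mulrCA.
Qed.

(** A move at p = 0 that crosses no wall: a flow family is a union of whole cells. *)
Lemma fam_sign Phi A v v' : flow_family Phi A -> A v ->
  (forall a, a \in Phi -> 0 < dot v a * dot v' a) -> A v'.
Proof.
move=> fA Av vv'; apply: (fam_move fA (p := 0) Av).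
- by move=> a Pa; case: (mulr_gt0_neq0 (vv' a Pa)).
- by move=> a Pa; rewrite dot0l eqxx.
by move=> a Pa; rewrite ltNge ltW ?vv'.
Qed.

Lemma mem_localize Phi p a : a \in localize Phi p = (dot p a == 0) && (a \in Phi).
Proof. by rewrite mem_filter. Qed.

(** For small e, a crossed wall must contain p, and it is crossed towards the side of [X]; by
    hypothesis this is the side of [g p] or of [g' p]. *)
Lemma cell_closure_step Phi A p X : flow_family Phi A -> cell_closure Phi A p ->
  (forall a, a \in Phi -> dot p a = 0 -> dot X a != 0 ->
     0 < dot X a * dot (g p) a \/ 0 < dot X a * dot (g' p) a) ->
  small (fun e => cell_closure Phi A (p + e *: X)).
Proof.
move=> fA [v Av pv] HX; have := small_sign Phi p X.
apply: small_sub => e e_gt0 se; set p2 := p + e *: X.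
(* Adding a small multiple of v puts the new point on the side of v for every wall through [p2], so
   none of those is crossed. *)
have [d d_gt0 sd] := small_ex (small_sign Phi p2 v).
have p2E a : dot p a = 0 -> dot p2 a = e * dot X a by rewrite !dotE => ->; rewrite add0r.
have v'E a : dot p2 a = 0 -> dot (p2 + d *: v) a = d * dot v a.
  by rewrite dotDl dotZl => ->; rewrite add0r.
have vg := fam_gen fA Av.
have gen' : generic Phi (p2 + d *: v).
  move=> a Pa; have [p2a|p2a] := eqVneq (dot p2 a) 0.
    by rewrite v'E// mulf_neq0 ?vg// gt_eqF.
  by case: (mulr_gt0_neq0 (sd a Pa p2a)).
exists (p2 + d *: v); last first.
  move=> a Pa; have [->|p2a] := eqVneq (dot p2 a) 0; first by rewrite mul0r.
  by rewrite ltW// sd.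
have signp a : a \in Phi -> dot p a != 0 ->
    0 < dot p a * dot v a /\ 0 < dot p a * dot (p2 + d *: v) a.
  move=> Pa pa; split; first by rewrite lt_neqAle pv// andbT eq_sym mulf_neq0// vg.
  have := se a Pa pa; rewrite -/p2 => pp2; apply: (mulr_gt0_trans pp2).
  by apply: sd => //; case: (mulr_gt0_neq0 pp2).
apply: (fam_move fA (p := p) Av gen' signp) => a Pa vv'.
have pa : dot p a = 0.
  apply/eqP/negPn/negP => /(signp _ Pa)[]; rewrite mulrC => h /(mulr_gt0_trans h).
  by rewrite ltNge ltW.
have p2a : dot p2 a != 0.
  apply: contraTneq vv' => p2a; rewrite v'E// -leNgt mulrCA.
  by rewrite mulr_ge0 ?(ltW d_gt0)// -expr2 sqr_ge0.
have Xa : dot X a != 0 by move: p2a; rewrite p2E// mulf_eq0 negb_or => /andP[].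
have v'X : 0 < dot (p2 + d *: v) a * dot X a.
  by have := sd a Pa p2a; rewrite p2E// mulrC mulrCA (pmulr_rgt0 _ e_gt0).
by case: (HX a Pa pa Xa) => h; [constructor 1|constructor 2]; apply: (mulr_gt0_trans v'X).
Qed.

Lemma cell_closure_steps Phi A p : flow_family Phi A -> cell_closure Phi A p ->
  [/\ small (fun e => cell_closure Phi A (p + e *: g p)),
      small (fun e => cell_closure Phi A (p + e *: g' p)) &
      small (fun e => cell_closure Phi A (p + e *: (g p + g' p)))].
Proof.
move=> fA Ap; split; apply: cell_closure_step => // a Pa pa X0.
- by left; exact: sqr_gt0.
- by right; exact: sqr_gt0.
(* A nonzero sum has the sign of at least one of its two summands. *)
have := sqr_gt0 X0; rewrite {2}dotDl mulrDr; case: (ltrP 0 (dot (g p + g' p) a * dot (g p) a)).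
  by left.
by move=> h1 h2; right; lra.
Qed.

Lemma cell_closure_cone Phi A c p : 0 < c -> cell_closure Phi A p ->
  cell_closure Phi A (c *: p).
Proof.
move=> c0 [v Av pv]; exists v => // a Pa.
by rewrite dotZl -mulrA mulr_ge0 ?(ltW c0)// pv.
Qed.

(** A point q of the set close to the limit p shares all nonzero signs of p, so the cell that serves
    q also serves p. *)
Lemma closed_cell_closure Phi A : closed (cell_closure Phi A : set (euclid V)).
Proof.
move=> p clp; have [q [[v Av qv] pq]] := clp _ (near_dot_sign dot Phi p).
exists v => // a Pa; have [->|pa] := eqVneq (dot p a) 0; first by rewrite mul0r.
have pqa := pq a Pa pa; have := qv a Pa.
rewrite le_eqVlt => /orP[/eqP/esym/eqP|qva]; last exact/ltW/(mulr_gt0_trans pqa).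
rewrite mulf_eq0 => /orP[/eqP q0|/eqP ->]; last by rewrite mulr0.
by move: pqa; rewrite q0 mulr0 ltxx.
Qed.

(** A move of the localized arrangement at p1 lifts to a move of the whole one at p + f p1. As [g p]
    and [g' p] lie on every hyperplane through p, only f times [g p1] and [g' p1] enter the crossing
    condition. *)
Lemma local_family_family Phi A p : flow_family Phi A ->
  (forall a, a \in Phi -> dot p a = 0 -> dot (g p) a = 0 /\ dot (g' p) a = 0) ->
  flow_family (localize Phi p) (local_family Phi A p).
Proof.
move=> fA pst; split=> [v []//|p1 eta eta' [eta_gen [v Av veta]] eta'_gen sg1 sg2].
split=> //; have [e e_gt0 se] := small_ex (small_sign Phi p eta').
have v'E a : dot p a = 0 -> dot (p + e *: eta') a = e * dot eta' a.
  by rewrite !dotE => ->; rewrite add0r.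
exists (p + e *: eta'); last first.
  move=> a Pa; case: ifPn => [|/negPn/eqP pa]; first exact: se.
  rewrite v'E// -mulrA mulr_gt0// sqr_gt0//; apply: eta'_gen.
  by rewrite mem_localize pa eqxx.
have [f f_gt0 sf] := small_ex (small_sign Phi p p1).
have p2E a : dot p a = 0 -> dot (p + f *: p1) a = f * dot p1 a.
  by rewrite !dotE => ->; rewrite add0r.
apply: (fam_move fA (p := p + f *: p1) Av).
- move=> a Pa; have [pa|pa] := eqVneq (dot p a) 0.
    by rewrite v'E// mulf_neq0 ?eta'_gen ?mem_localize ?pa ?eqxx// gt_eqF.
  by case: (mulr_gt0_neq0 (se a Pa pa)).
- move=> a Pa p2a; have := veta a Pa; have [pa|pa] := eqVneq (dot p a) 0 => /= vp.
    have Pla : a \in localize Phi p by rewrite mem_localize pa eqxx.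
    move: p2a; rewrite p2E// v'E// mulf_eq0 negb_or => /andP[_ p1a].
    have [h1 h2] := sg1 a Pla p1a; split; last by rewrite mulrACA mulr_gt0// mulr_gt0.
    by rewrite -mulrA mulr_gt0//; apply: (mulr_gt0_trans h1); rewrite mulrC.
  have := sf a Pa pa; rewrite mulrC => pf.
  by split; apply: (mulr_gt0_trans pf) => //; exact: se.
move=> a Pa vv'; have := veta a Pa; have [pa|pa] := eqVneq (dot p a) 0 => /= vp; last first.
  by move: vp; rewrite mulrC => /mulr_gt0_trans/(_ (se a Pa pa)); rewrite ltNge ltW.
have Pla : a \in localize Phi p by rewrite mem_localize pa eqxx.
have ee' : dot eta a * dot eta' a < 0.
  rewrite ltNge le_eqVlt; apply/negP => /orP[|h].
    rewrite eq_sym mulf_eq0 => /orP[h|h]; first by move: (eta_gen a Pla); rewrite h.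
    by move: (eta'_gen a Pla); rewrite h.
  by have := mulr_gt0_trans vp h; move: vv'; rewrite v'E// mulrCA pmulr_rlt0// ltNge => /negP h1 /ltW.
have [gp g'p] := pst a Pa pa.
have E1 : dot (g (p + f *: p1)) a = f * dot (g p1) a by rewrite linearD linearZ !dotE gp add0r.
have E2 : dot (g' (p + f *: p1)) a = f * dot (g' p1) a by rewrite linearD linearZ !dotE g'p add0r.
rewrite E1 E2 v'E//; case: (sg2 a Pla ee') => h; [constructor 1|constructor 2|by constructor 3].
  by rewrite mulrACA mulr_gt0// mulr_gt0.
by rewrite mulrACA mulr_gt0// mulr_gt0.
Qed.

Lemma local_family_inh Phi A p : flow_family Phi A -> cell_closure Phi A p ->
  exists eta, local_family Phi A p eta.
Proof.
move=> fA [v Av pv]; have vg := fam_gen fA Av.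
exists v; split; first by move=> a; rewrite mem_localize => /andP[_ /vg].
exists v => // a Pa; case: ifPn => pa; last exact/sqr_gt0/vg.
by rewrite lt_neqAle pv// andbT eq_sym mulf_neq0// vg.
Qed.

Lemma local_familyP Phi A p eta : flow_family Phi A -> local_family Phi A p eta ->
  small (fun e => A (p + e *: eta)).
Proof.
move=> fA [eta_gen [v Av veta]]; have := small_sign Phi p eta.
apply: small_sub => e e_gt0 se; apply: (fam_sign fA Av) => a Pa.
have := veta a Pa; have [pa|pa] := eqVneq (dot p a) 0 => /= vp.
  by rewrite !dotE pa add0r mulrCA mulr_gt0.
by apply: mulr_gt0_trans (se a Pa pa); rewrite mulrC.
Qed.

Lemma opp_family Phi A : flow_family Phi A -> flow_family Phi (fun v => A (- v)).
Proof.
move=> fA; split=> [v /(fam_gen fA) vg a /vg|p v v' Av v'g s1 s2].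
  by rewrite dotNl oppr_eq0.
apply: (fam_move fA (p := - p) Av).
- by move=> a /v'g; rewrite dotNl oppr_eq0.
- by move=> a Pa; rewrite !dotNl !mulrNN oppr_eq0; exact: s1.
by move=> a Pa; rewrite !linearN !dotNl !mulrNN; exact: s2.
Qed.

End Families.

(** * Any two flow families meet *)

Section Meeting.
Variables (R : realType) (V : vectType R) (dot : {dot V for idfun}).
Variables g g' : 'End(V).
Hypothesis gK : forall v, g' (g v) = v.
Hypothesis g'K : forall v, g (g' v) = v.
Hypothesis gdot : forall u v, dot (g u) (g v) = dot u v.
Implicit Types (Phi : seq V) (A B : V -> Prop) (p q v : V).
Local Notation flow_family := (flow_family dot g g').
Local Notation cell_closure := (cell_closure dot).

Lemma dot_adj u v : dot (g u) v = dot u (g' v).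
Proof. by rewrite -{1}(g'K v) gdot. Qed.

Lemma dot_adj' u v : dot (g' u) v = dot u (g v).
Proof. by rewrite dotC -dot_adj dotC. Qed.

(** Gram-Schmidt on the list: [b - f] is the component of the new vector orthogonal to the earlier
    span, and either vanishes or supplies the correction term. *)
Lemma span_projection Phi v :
  exists2 e, e \in <<Phi>>%VS & forall a, a \in Phi -> dot (v - e) a = 0.
Proof.
elim: Phi v => [|b Phi IH] v; first by exists 0; rewrite ?mem0v.
have [e eP ve] := IH v; have [f fP bf] := IH b.
have sP : (<<Phi>> <= <<b :: Phi>>)%VS by rewrite span_cons addvSr.
have b'a a : a \in <<Phi>>%VS -> dot (b - f) a = 0.
  move=> aP; rewrite (coord_span (X := in_tuple Phi) aP) linear_sumr /=.
  by apply: big1 => i _; rewrite dotZr bf ?mulr0// mem_nth.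
have [b0|b0] := eqVneq (b - f) 0.
  exists e; first exact: (subvP sP).
  move=> a; rewrite inE => /orP[/eqP->|/ve//].
  move/eqP: b0; rewrite subr_eq0 => /eqP ->.
  rewrite (coord_span (X := in_tuple Phi) fP) linear_sumr /=.
  by apply: big1 => i _; rewrite dotZr ve ?mulr0// mem_nth.
have bP : b \in <<b :: Phi>>%VS by rewrite memv_span ?mem_head.
have b'P : b - f \in <<b :: Phi>>%VS by rewrite rpredB// (subvP sP).
have bb : dot (b - f) (b - f) != 0 by rewrite dot_eq0.
set c := dot (v - e) (b - f) / dot (b - f) (b - f).
exists (e + c *: (b - f)); first by rewrite rpredD ?rpredZ// (subvP sP).
have onP a : a \in <<Phi>>%VS -> dot (v - (e + c *: (b - f))) a = 0.
  move=> aP; rewrite opprD addrA dotDl dotNl dotZl b'a// mulr0 subr0.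
  rewrite (coord_span (X := in_tuple Phi) aP) linear_sumr /=.
  by apply: big1 => i _; rewrite dotZr ve ?mulr0// mem_nth.
move=> a; rewrite inE => /orP[/eqP->|aP]; last by rewrite onP// memv_span.
rewrite -[X in dot _ X](subrK f) dotDr (onP f)// addr0.
by rewrite opprD addrA dotDl dotNl dotZl mulfVK// subrr.
Qed.

(** * The top eigenspace of g + g^-1 *)

Section TopEigenspace.
Variables (Phi : seq V) (lam : R).
Local Notation E := <<Phi>>%VS.
Hypothesis gE : forall v, v \in E -> g v \in E /\ g' v \in E.
Hypothesis topE : forall v, v \in E -> dot (g v + g' v) v <= lam * dot v v.
Hypothesis lam2 : lam ^+ 2 < 4.

(** Here g^2 - lam g + 1 = 0, so g rotates by an angle theta with 2 cos theta = lam; the bound on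
    [lam] keeps theta strictly between 0 and pi. *)
Definition topspace : {vspace V} := (E :&: lker (g + g' - lam *: \1)%VF)%VS.
Local Notation F := topspace.

Lemma topspaceP v : reflect (v \in E /\ g v + g' v = lam *: v) (v \in F).
Proof.
rewrite memv_cap memv_ker !add_lfunE opp_lfunE scale_lfunE id_lfunE subr_eq0.
by apply: (iffP andP) => -[vE /eqP].
Qed.

Lemma topspace_g v : v \in F -> g v \in F.
Proof.
move=> /topspaceP[vE vM]; apply/topspaceP; split; first by case: (gE vE).
have -> : lam *: g v = g (lam *: v) by rewrite linearZ.
by rewrite -vM linearD /= gK g'K.
Qed.

Lemma topspace_dot v : v \in F -> 2 * dot (g v) v = lam * dot v v.
Proof.
move=> /topspaceP[_ vM]; rewrite -dotZl -vM dotDl dot_adj' [dot v _]dotC; ring.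
Qed.

Lemma topspace_norm v e : v \in F ->
  dot (v + e *: g v) (v + e *: g v) = (1 + e * lam + e ^+ 2) * dot v v.
Proof.
move=> vF; have h := topspace_dot vF; rewrite !dotE gdot [dot v (g v)]dotC.
have -> : dot (g v) v = lam * dot v v / 2 by rewrite -h; field.
by field.
Qed.

Lemma norm_poly_gt0 e : 0 < 1 + e * lam + e ^+ 2.
Proof.
have -> : 1 + e * lam + e ^+ 2 = (e + lam / 2) ^+ 2 + (4 - lam ^+ 2) / 4 by field.
by rewrite ltr_wpDl ?sqr_ge0// divr_gt0 ?subr_gt0.
Qed.

(** The form lam (x, x) - (M x, x) is nonnegative on E, so its gradient vanishes at a zero: a step
    from x against the residual y gives (y, y) <= 0 to first order. *)
Lemma top_eigenvector x : x \in E -> lam * dot x x <= dot (g x + g' x) x -> x \in F.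
Proof.
move=> xE xM; apply/topspaceP; split=> //.
set y := lam *: x - (g x + g' x).
have yE : y \in E by have [? ?] := gE xE; rewrite rpredB ?rpredZ ?rpredD.
suff : dot y y <= 0 by move=> yy; apply/esym/eqP; rewrite -subr_eq0 -/y -(dot_eq0 dot) eq_le yy dot_ge0.
have M e : lam * dot (x - e *: y) (x - e *: y) - dot (g (x - e *: y) + g' (x - e *: y)) (x - e *: y) =
   (lam * dot x x - dot (g x + g' x) x) - 2 * e * dot y y + e ^+ 2 * (lam * dot y y - dot (g y + g' y) y).
  have -> : g (x - e *: y) + g' (x - e *: y) = (g x + g' x) - e *: (g y + g' y).
    have L (f : 'End(V)) : f (x - e *: y) = f x - e *: f y by rewrite linearB linearZ.
    by rewrite !L scalerDr opprD addrACA.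
  have sym : dot (g y + g' y) x = dot (g x + g' x) y.
    by rewrite dotDl dot_adj dot_adj' -dotDr dotC addrC.
  have yy : dot y y = lam * dot x y - dot (g x + g' x) y.
    by rewrite {1}/y dotDl dotNl dotZl.
  clearbody y; move: (g y + g' y) (g x + g' x) sym yy => Ty Tx sym yy.
  by rewrite !dotE sym [dot y x]dotC yy; ring.
apply: (@le_small _ _ _ ((lam * dot y y - dot (g y + g' y) y) / 2)).
exists 1 => // e /andP[e_gt0 _]; rewrite add0r.
have exE : x - e *: y \in E by rewrite rpredB ?rpredZ.
have := topE exE; rewrite -subr_ge0 M => h.
have : 0 <= e * (- dot y y + e * ((lam * dot y y - dot (g y + g' y) y) / 2)).
  lra.
by rewrite pmulr_rge0// => ?; lra.
Qed.

(* Moving p by g p + g^-1 p would bring it closer to u. *)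
Lemma maximizer_topspace A p u : flow_family Phi A -> u \in F -> p \in E ->
  cell_closure Phi A p -> dot p p = 1 -> 0 < dot p u ->
  (forall x, x \in E -> cell_closure Phi A x ->
     dot x u <= dot p u * Num.sqrt (dot x x)) -> p \in F.
Proof.
move=> fA /topspaceP[uE uM] pE Ap pp pu pmax.
apply: top_eigenvector => //; rewrite pp mulr1.
(* Multiplied by (p, u) > 0, the goal is the first-order condition at p in the direction M p,
   because (M p, u) = lam (p, u). *)
rewrite -(ler_pM2l pu).
apply: (@le_sqrt_small _ _ _ _ (dot (g p + g' p) (g p + g' p))).
have [_ _] := cell_closure_steps fA Ap; apply: small_sub => e e_gt0 Ae.
have gpE : p + e *: (g p + g' p) \in E by have [? ?] := gE pE; rewrite rpredD ?rpredZ ?rpredD.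
have := pmax _ gpE Ae; rewrite dotDl dotZl.
have -> : dot (g p + g' p) u = dot p u * lam.
  by rewrite mulrC -dotZr -uM dotDl dot_adj dot_adj' addrC -dotDr.
suff -> : dot (p + e *: (g p + g' p)) (p + e *: (g p + g' p)) =
  1 + 2 * e * dot (g p + g' p) p + e ^+ 2 * dot (g p + g' p) (g p + g' p) by [].
by move: (g p + g' p) => M; rewrite !dotE pp [dot p M]dotC; ring.
Qed.


Lemma topspace_norm' v e : v \in F ->
  dot (v + e *: g' v) (v + e *: g' v) = (1 + e * lam + e ^+ 2) * dot v v.
Proof.
move=> vF; rewrite -topspace_norm// !dotE gdot -(gdot (g' v) (g' v)) !g'K.
by rewrite !dot_adj' [dot v (g' v)]dotC !dot_adj' [dot (g v) v]dotC; ring.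
Qed.

Lemma cell_closure_opp A v :
  cell_closure Phi (fun w => A (- w)) v <-> cell_closure Phi A (- v).
Proof.
split=> -[w Aw vw]; exists (- w); rewrite ?opprK// => a Pa.
  by rewrite !dotNl mulrNN vw.
by have := vw a Pa; rewrite !dotNl mulNr mulrN.
Qed.

(** A nonzero p in the plane spans it together with [g p]: the determinant expressing p and [g p] in
    [p0] and [g p0] is [D], which is also (p, p) / (p0, p0). *)
Lemma plane_residue p0 p r :
  let P := <<[:: p0; g p0]>>%VS in
  p0 \in F -> p0 != 0 -> p \in P -> r \in P -> p != 0 ->
  dot r p = 0 -> dot r (g p) = 0 -> r = 0.
Proof.
move=> P p0F p00 pP rP pn0 rp rgp.
have PE v : v \in P -> exists x y, v = x *: p0 + y *: g p0.
  rewrite /P span_cons span_seq1 => /memv_addP[_ /vlineP[x ->] [_ /vlineP[y ->] ->]].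
  by exists x, y.
have ggp0 : g (g p0) = lam *: g p0 - p0.
  have /topspaceP[_] := topspace_g p0F; rewrite gK => <-; by rewrite addrK.
have [x [y pE]] := PE p pP; have [z [t rE]] := PE r rP.
pose D := x ^+ 2 + lam * x * y + y ^+ 2.
have gpE : g p = x *: g p0 + y *: (lam *: g p0 - p0).
  by rewrite pE linearD !linearZ /= ggp0.
have Dp : dot p p = D * dot p0 p0.
  have h := topspace_dot p0F; rewrite pE !dotE gdot [dot p0 (g p0)]dotC /D.
  by have -> : dot (g p0) p0 = lam * dot p0 p0 / 2 by [rewrite -h; field]; field.
have D0 : D != 0 by apply: contraNneq pn0 => D0; rewrite -(dot_eq0 dot) Dp D0 mul0r.
have r1 : dot r p0 = 0.
  apply: (mulfI D0); rewrite mulr0.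
  transitivity ((x + lam * y) * dot r p - y * dot r (g p)); last by rewrite rp rgp; ring.
  by rewrite gpE pE !dotE /D; ring.
have r2 : dot r (g p0) = 0.
  apply: (mulfI D0); rewrite mulr0.
  transitivity (y * dot r p + x * dot r (g p)); last by rewrite rp rgp; ring.
  by rewrite gpE pE !dotE /D; ring.
by apply/eqP; rewrite -(dot_eq0 dot) {2}rE dotDr !dotZr r1 r2 !mulr0 addr0.
Qed.

(* Inside the plane of p0 and g p0 the moves by g and by g^-1 rotate in both
   directions, so the maximal angle cosine between A and -A is 1. *)
Lemma plane_meet A p0 : flow_family Phi A -> p0 \in F -> p0 != 0 ->
  cell_closure Phi A p0 ->
  exists q, [/\ q \in F, q != 0, cell_closure Phi A q & cell_closure Phi A (- q)].
Proof.
move=> fA p0F p00 Ap0; pose P := <<[:: p0; g p0]>>%VS.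
have PF v : v \in P -> v \in F.
  apply: subvP v; apply/span_subvP => a; rewrite !inE => /orP[] /eqP -> //.
  exact: topspace_g.
have p0P : p0 \in P by rewrite memv_span// mem_head.
have gp0P : g p0 \in P by rewrite memv_span// !inE eqxx orbT.
have ggp0 : g (g p0) = lam *: g p0 - p0.
  have /topspaceP[_] := topspace_g p0F; rewrite gK => <-; by rewrite addrK.
have gP v : v \in P -> g v \in P.
  rewrite {1}/P span_cons span_seq1 => /memv_addP[_ /vlineP[x ->] [_ /vlineP[y ->] ->]].
  by rewrite linearD !linearZ /= ggp0 rpredD ?rpredZ// rpredB ?rpredZ.
have g'E v : v \in P -> g' v = lam *: v - g v.
  by move=> /PF /topspaceP[_ <-]; rewrite addrC addKr.
pose K : set (euclid V) := cell_closure Phi A `&` [set v | (v : V) \in P].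
pose L : set (euclid V) := cell_closure Phi (fun w => A (- w)) `&` [set v | (v : V) \in P].
have cK : closed K by apply: closedI; [exact: closed_cell_closure|exact: closed_vspace].
have cL : closed L by apply: closedI; [exact: closed_cell_closure|exact: closed_vspace].
have coneK : cone K by move=> c v c0 [Av /= vP]; split; [exact: cell_closure_cone|exact: memvZ].
have coneL : cone L by move=> c v c0 [Av /= vP]; split; [exact: cell_closure_cone|exact: memvZ].
have Lp0 : L (- p0) by split; [apply/cell_closure_opp; rewrite opprK|rewrite /= memvN].
have np0 : - p0 != 0 by rewrite oppr_eq0.
have [p [q [[Ap /= pP] pp [Aq /= qP] qq pq]]] :=
  dot_pair_max dot cK cL coneK coneL (conj Ap0 p0P : K p0) p00 Lp0 np0.
set m := dot p q in pq.
have pn0 : p != 0 by rewrite -(dot_eq0 dot) pp oner_eq0.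
have gpP := gP _ pP.
have qL : L q by [].
have [s1 s2 _] := cell_closure_steps fA Ap.
(* First-order maximality: neither of the two rotations of p increases the cosine with q. *)
have le1 : dot (g p) q <= m * (lam / 2).
  apply: (@le_sqrt_small _ _ _ _ 1); apply: small_sub s1 => e e_gt0 Ae.
  have := pq _ q (conj Ae (rpredD pP (rpredZ e gpP))) qL.
  rewrite qq sqrtr1 topspace_norm ?PF// pp !mulr1 dotDl dotZl.
  by have -> : 1 + 2 * e * (lam / 2) = 1 + e * lam by field.
have le2 : dot (g' p) q <= m * (lam / 2).
  apply: (@le_sqrt_small _ _ _ _ 1); apply: small_sub s2 => e e_gt0 Ae.
  have g'pP : g' p \in P by rewrite g'E// rpredB// rpredZ.
  have := pq _ q (conj Ae (rpredD pP (rpredZ e g'pP))) qL.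
  rewrite qq sqrtr1 topspace_norm' ?PF// pp !mulr1 dotDl dotZl.
  by have -> : 1 + 2 * e * (lam / 2) = 1 + e * lam by field.
(* Since g' p = lam p - g p, the second bound is the reverse of the first. *)
have gpq : dot (g p) q = m * (lam / 2).
  move: le2; rewrite g'E// dotDl dotNl dotZl -/m => le2.
  by apply/eqP; rewrite eq_le le1 /=; lra.
have qE : q = m *: p.
  apply/eqP; rewrite -subr_eq0; apply/eqP.
  apply: (@plane_residue p0 p) => //; first by rewrite rpredB// rpredZ.
    by rewrite dotDl dotNl dotZl pp dotC -/m; ring.
  have := topspace_dot (PF _ pP); rewrite pp => h.
  by rewrite dotDl dotNl dotZl dotC gpq dotC; move: h; set d := dot _ _ => h; nra.
have m2 : m ^+ 2 = 1 by rewrite -qq qE !dotE pp; ring.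
exists p; split=> //; first exact: PF.
apply/cell_closure_opp.
suff m1 : m = 1 by move: Aq; rewrite qE m1 scale1r.
(* If m = -1, then q = -p and any rotation raises the cosine: maximality would give 1 + e lam + e^2
   <= (1 + e lam / 2)^2, against lam^2 < 4. *)
have /orP[/eqP//|/eqP mN1] : (m == 1) || (m == -1) by rewrite -eqf_sqr m2 expr1n.
have [e e_gt0 Ae] := small_ex s1.
have := pq _ q (conj Ae (rpredD pP (rpredZ e gpP))) qL.
rewrite qq sqrtr1 topspace_norm ?PF// pp !mulr1 dotDl dotZl gpq -/m mN1.
set N := 1 + _ + _; have N0 : 0 <= N by exact/ltW/norm_poly_gt0.
have := sqr_sqrtr N0; have := sqrtr_ge0 N; set s := Num.sqrt N => s0 sN le_s.
have : s ^+ 2 <= (1 + e * lam / 2) ^+ 2 by rewrite ler_sqr ?nnegrE; lra.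
rewrite sN /N => h; have e2 : 0 < e ^+ 2 by rewrite exprn_gt0.
by have : 0 < e ^+ 2 * (4 - lam ^+ 2) by [rewrite mulr_gt0// subr_gt0]; nra.
Qed.

(** Projection to the span changes no sign, hence stays in the cell; cells are open, so a small push
    along u then leaves the hyperplane orthogonal to u. *)
Lemma family_off_hyperplane A u : flow_family Phi A -> (exists v, A v) ->
  u \in E -> u != 0 -> exists v, [/\ A v, v \in E & dot v u != 0].
Proof.
move=> fA [v Av] uE u0; have [w wE vw] := span_projection Phi v.
have vg := fam_gen fA Av.
have Aw : A w.
  apply: (fam_sign fA Av) => a Pa; have := vw a Pa; rewrite dotDl dotNl => /eqP.
  by rewrite subr_eq0 => /eqP <-; exact/sqr_gt0/vg.
have [wu|wu] := eqVneq (dot w u) 0; last by exists w.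
have wg := fam_gen fA Aw.
have [e e_gt0 se] := small_ex (small_sign dot Phi w u).
exists (w + e *: u); split; last 1 first.
- by rewrite dotDl dotZl wu add0r mulf_neq0 ?dot_eq0// gt_eqF.
- by apply: (fam_sign fA Aw) => a Pa; apply: se => //; exact: wg.
by rewrite rpredD ?rpredZ.
Qed.

(** The points u and -u make the maximum positive: some v in [A] is not orthogonal to u, so it has
    positive inner product with one of them. *)
Lemma spanned_cell_max A (W : {vspace V}) B u :
  flow_family Phi A -> (exists v, A v) -> u \in W -> u \in E -> u != 0 ->
  cell_closure Phi B u -> cell_closure Phi B (- u) ->
  exists p q, [/\ p \in E, cell_closure Phi A p, q \in W & cell_closure Phi B q] /\
    [/\ dot p p = 1, dot q q = 1, 0 < dot p q &
    forall x y, x \in E -> cell_closure Phi A x -> y \in W -> cell_closure Phi B y ->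
      dot x y <= dot p q * (Num.sqrt (dot x x) * Num.sqrt (dot y y))].
Proof.
move=> fA neA uW uE u0 Bu BNu.
have [v [Av vE vu]] := family_off_hyperplane fA neA uE u0.
have v0 : v != 0 by apply: contraNneq vu => ->; rewrite dot0l.
pose K : set (euclid V) := cell_closure Phi A `&` [set v | (v : V) \in E].
pose L : set (euclid V) := cell_closure Phi B `&` [set v | (v : V) \in W].
have cK : closed K by apply: closedI; [exact: closed_cell_closure|exact: closed_vspace].
have cL : closed L by apply: closedI; [exact: closed_cell_closure|exact: closed_vspace].
have coneK : cone K by move=> c w c0 [Aw /= wP]; split; [exact: cell_closure_cone|exact: memvZ].
have coneL : cone L by move=> c w c0 [Aw /= wP]; split; [exact: cell_closure_cone|exact: memvZ].
have Kv : K v.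
  split=> //; exists v => // a Pa; rewrite -expr2; exact: sqr_ge0.
have Lu : L u by [].
have LNu : L (- u) by split=> //=; rewrite memvN.
have [p [q [[Ap /= pE] pp [Bq /= qW] qq pq]]] :=
  dot_pair_max dot cK cL coneK coneL Kv v0 Lu u0.
exists p, q; split=> //; split=> //; last by move=> x y xE Ax yW By; exact: pq.
rewrite ltNge; apply/negP => pq0.
have s_gt0 : 0 < Num.sqrt (dot v v) * Num.sqrt (dot u u).
  by rewrite mulr_gt0// dot_sqrt_gt0.
have le0 : dot p q * (Num.sqrt (dot v v) * Num.sqrt (dot u u)) <= 0.
  by rewrite mulr_le0_ge0// ltW.
have := pq _ _ Kv Lu; have := pq _ _ Kv LNu; rewrite !dotNr dotNl opprK => h1 h2.
have h3 := le_trans h1 le0; have h4 := le_trans h2 le0.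
by move: vu; rewrite eq_le h4 /= -oppr_le0 h3.
Qed.

(** With the family of all vectors as [B], the second cone is all of F; a point of the closure of
    [A] at the smallest angle to F must lie in F. *)
Lemma family_meets_topspace A u : flow_family Phi A -> (exists v, A v) ->
  u \in F -> u != 0 ->
  exists p, [/\ p \in F, p != 0 & cell_closure Phi A p].
Proof.
move=> fA neA uF u0.
have uE : u \in E by case/topspaceP: uF.
have allT v : cell_closure Phi (fun=> True) v.
  by exists v => // a _; rewrite -expr2 sqr_ge0.
have [p [q [[pE Ap qF _] [pp qq pq_gt0 pq]]]] :=
  spanned_cell_max fA neA uF uE u0 (allT _) (allT _).
exists p; split=> //; last by rewrite -(dot_eq0 dot) pp oner_eq0.
apply: (maximizer_topspace fA qF) => // x xE Ax.
by have := pq x q xE Ax qF (allT _); rewrite qq sqrtr1 mulr1.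
Qed.

Lemma rotated_stable p : p \in F ->
  small (fun e => forall a, a \in Phi -> dot (p + e *: g p) a = 0 ->
    dot (g (p + e *: g p)) a = 0 /\ dot (g' (p + e *: g p)) a = 0).
Proof.
move=> pF; apply: small_sub (small_sign dot Phi p (g p)) => e e_gt0 se a Pa.
have [pa|pa] := eqVneq (dot p a) 0; last first.
  by move=> p0; have := se a Pa pa; rewrite p0 mulr0 ltxx.
rewrite dotDl dotZl pa add0r => /eqP; rewrite mulf_eq0 gt_eqF//= => /eqP gpa.
have /topspaceP[_ ME] := pF; have /topspaceP[_ MgE] := topspace_g pF.
have g'pa : dot (g' p) a = 0.
  by have := congr1 (dot^~ a) ME; rewrite /= dotDl dotZl gpa pa add0r mulr0.
have ggpa : dot (g (g p)) a = 0.
  by have := congr1 (dot^~ a) MgE; rewrite /= gK dotDl dotZl gpa pa addr0 mulr0.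
by rewrite !linearD !linearZ /= gK !dotDl !dotZl gpa g'pa ggpa pa !mulr0 !addr0.
Qed.

(* v |-> v + e g v is a similarity of the top eigenspace, so it maps a closest
   pair to a closest pair; a wall through p + e g p for small e contains both p
   and g p, hence is g-stable. *)
Lemma stable_max_pair A B u : flow_family Phi A -> flow_family Phi B ->
  (exists v, A v) -> (exists v, B v) -> u \in F -> u != 0 ->
  exists p q m,
  [/\ p \in F, p != 0, cell_closure Phi A p, 0 < m &
    forall a, a \in Phi -> dot p a = 0 -> dot (g p) a = 0 /\ dot (g' p) a = 0] /\
  [/\ q \in F, cell_closure Phi B q, dot q q = dot p p, dot p q = m * dot p p &
    forall x, x \in E -> cell_closure Phi A x ->
      dot x q <= m * (Num.sqrt (dot x x) * Num.sqrt (dot q q))].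
Proof.
move=> fA fB neA neB uF u0.
have [q0 [q0F q00 Bq0]] := family_meets_topspace fB neB uF u0.
(* Having both q1 and -q1 in the closure of [B] is what makes the maximal inner product positive. *)
have [q1 [q1F q10 Bq1 BNq1]] := plane_meet fB q0F q00 Bq0.
have q1E : q1 \in E by case/topspaceP: q1F.
have [p [q [[pE Ap qF Bq] [pp qq pq_gt0 pq]]]] :=
  spanned_cell_max fA neA q1F q1E q10 Bq1 BNq1.
have pF : p \in F.
  apply: (maximizer_topspace fA qF) => // x xE Ax.
  by have := pq x q xE Ax qF Bq; rewrite qq sqrtr1 mulr1.
have [sA _ _] := cell_closure_steps fA Ap; have [sB _ _] := cell_closure_steps fB Bq.
have [e e_gt0 [Ae [Be st]]] :=
  small_ex (small_and sA (small_and sB (rotated_stable pF))).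
have N_gt0 := norm_poly_gt0 e.
have pN := topspace_norm e pF; have qN := topspace_norm e qF.
have pqN : dot (p + e *: g p) (q + e *: g q) = dot p q * (1 + e * lam + e ^+ 2).
  (* The two cross terms add up to lam (p, q), so the inner product is scaled by the same factor as
     the norms. *)
  have : dot (g p) q + dot p (g q) = lam * dot p q.
    by have /topspaceP[_ ME] := pF; rewrite -dot_adj' -dotDl ME dotZl.
  by rewrite !dotE gdot; move: (dot (g p) q) (dot p (g q)) => x y h; nra.
exists (p + e *: g p), (q + e *: g q), (dot p q).
rewrite pN qN pqN pp qq !mulr1; split; split=> //.
- by rewrite rpredD ?rpredZ ?topspace_g.
- by rewrite -(dot_eq0 dot) pN pp mulr1 gt_eqF.
- by rewrite rpredD ?rpredZ ?topspace_g.
move=> x xE Ax; have qeF : q + e *: g q \in F by rewrite rpredD ?rpredZ ?topspace_g.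
by have := pq x _ xE Ax qeF Be; rewrite qN qq mulr1.
Qed.

End TopEigenspace.
Definition stable_roots Phi := forall a, a \in Phi -> g a \in Phi /\ g' a \in Phi.

Lemma localize_stable Phi p : stable_roots Phi ->
  (forall a, a \in Phi -> dot p a = 0 -> dot (g p) a = 0 /\ dot (g' p) a = 0) ->
  stable_roots (localize dot Phi p).
Proof.
move=> st pst a; rewrite !mem_localize => /andP[/eqP pa Pa].
have [ga g'a] := st a Pa; have [gp g'p] := pst a Pa pa.
by rewrite ga g'a -dot_adj -dot_adj' gp g'p eqxx.
Qed.

(** A nonzero vector of the span is not orthogonal to all of [Phi]; this drives the induction on the
    number of normals. *)
Lemma size_localize Phi p : p \in <<Phi>>%VS -> p != 0 ->
  (size (localize dot Phi p) < size Phi)%N.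
Proof.
move=> pE p0; rewrite size_filter -(count_predC (fun a => dot p a == 0) Phi).
rewrite -addn1 leq_add2l -has_count; apply: contraNT p0 => /hasPn pPhi.
rewrite -(dot_eq0 dot) {2}(coord_span (X := in_tuple Phi) pE) linear_sumr /=.
apply/eqP/big1 => i _; rewrite dotZr.
by have /negPn/eqP -> := pPhi _ (mem_nth 0 (ltn_ord i)); rewrite mulr0.
Qed.

Lemma span_stable Phi v : stable_roots Phi -> v \in <<Phi>>%VS ->
  g v \in <<Phi>>%VS /\ g' v \in <<Phi>>%VS.
Proof.
move=> st vE; rewrite (coord_span (X := in_tuple Phi) vE) !linear_sum /=.
split; apply: rpred_sum => i _; rewrite linearZ rpredZ// memv_span//;
  by case: (st _ (mem_nth 0 (ltn_ord i))).
Qed.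

Lemma flow_families_meet Phi A B : stable_roots Phi ->
  (forall v, g v = v -> forall a, a \in Phi -> dot v a = 0) ->
  flow_family Phi A -> flow_family Phi B ->
  (exists v, A v) -> (exists v, B v) -> exists v, A v /\ B v.
Proof.
have [n] := ubnP (size Phi); elim: n => // n IH in Phi A B *.
rewrite ltnS => szPhi st fixg fA fB neA neB.
have [/allP gN|/allPn[a Pa ga]] := boolP (all (fun a => g a == - a) Phi).
  have [v Av] := neA; have [w Bw] := neB; exists w; split=> //.
  apply: (fam_move fA (p := 0) Av); first exact: (fam_gen fB Bw).
    by move=> a _; rewrite dot0l eqxx.
  by move=> a Pa _; constructor 3; apply/eqP/gN.
have a0 : a != 0 by apply: contraNneq ga => ->; rewrite linear0 oppr0.
have aE : a \in <<Phi>>%VS by rewrite memv_span.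
have gE v : v \in <<Phi>>%VS -> g v \in <<Phi>>%VS /\ g' v \in <<Phi>>%VS.
  exact: span_stable.
have [lam [u [uE u0 uM]]] := top_eigenvalue dot (g + g')%VF aE a0.
have GE v : (g + g')%VF v = g v + g' v by rewrite add_lfunE.
move: uM; rewrite /= GE => uM topE'.
have topE v : v \in <<Phi>>%VS -> dot (g v + g' v) v <= lam * dot v v.
  by move=> vE; have := topE' v vE; rewrite /= GE.
have symM v : dot (g v + g' v) v = 2 * dot (g v) v.
  by rewrite dotDl dot_adj' [dot v _]dotC; ring.
(* The squared norm of g a + a, which is positive, equals (M a, a) + 2 (a, a). *)
have lam_gtN2 : - 2 < lam.
  have a2 : 0 < dot a a by exact: dot_gt0.
  rewrite -(ltr_pM2r a2); apply: lt_le_trans (topE a aE); rewrite symM.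
  have : 0 < dot (g a + a) (g a + a) by rewrite dot_gt0// addr_eq0.
  by rewrite !dotE gdot [dot a (g a)]dotC; lra.
have uF : u \in topspace Phi lam by apply: top_eigenvector => //; rewrite uM.
(* For lam >= 2 the vector u would be fixed by g, hence orthogonal to all normals, although it is a
   nonzero element of their span. *)
have lam_lt2 : lam < 2.
  rewrite ltNge; apply/negP => lam2; move/eqP: u0; apply.
  have u2 := dot_ge0 dot u.
  have gu : g u = u.
    apply/eqP; rewrite -subr_eq0 -(dot_eq0 dot) eq_le dot_ge0 andbT.
    have := ler_wpM2r u2 lam2; rewrite -uM symM !dotE gdot [dot u (g u)]dotC; lra.
  apply/eqP; rewrite -(dot_eq0 dot) {2}(coord_span (X := in_tuple Phi) uE) linear_sumr /=.
  apply/eqP/big1 => i _; rewrite dotZr.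
  by rewrite (fixg _ gu) ?mulr0// (mem_nth 0 (ltn_ord i)).
have lam2 : lam ^+ 2 < 4.
  have : 0 < (lam + 2) * (2 - lam) by rewrite mulr_gt0; lra.
  nra.
have [p [q [m [[pF p0 Ap m_gt0 pst] [qF Bq qq pq pmax]]]]] :=
  stable_max_pair gE topE lam2 fA fB neA neB uF u0.
have pE : p \in <<Phi>>%VS by case/topspaceP: pF.
have qE : q \in <<Phi>>%VS by case/topspaceP: qF.
have sz : (size (localize dot Phi p) < n)%N.
  exact: leq_trans (size_localize pE p0) szPhi.
have fixl v : g v = v -> forall b, b \in localize dot Phi p -> dot v b = 0.
  by move=> gv b; rewrite mem_localize => /andP[_]; exact: fixg.
have stl := localize_stable st pst.
have fAp := local_family_family fA pst.
have neAp := local_family_inh fA Ap.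
have [qEp|qp] := eqVneq q p.
  move: Bq; rewrite qEp => Bp.
  have [eta [Aeta Beta]] := IH _ _ _ sz stl fixl fAp (local_family_family fB pst)
    neAp (local_family_inh fB Bp).
  have [e _ [? ?]] := small_ex (small_and (local_familyP fA Aeta) (local_familyP fB Beta)).
  by exists (p + e *: eta).
(* Both eta and -eta point into A at p, so one of them leads to a point of A
   closer to q. *)
have pp : 0 < dot p p by exact: dot_gt0.
(* The part of q orthogonal to p; if it vanished, equal norms and m > 0 would force q = p. *)
set r := q - m *: p.
have rp : dot p r = 0 by rewrite /r !dotE pq; ring.
have r0 : r != 0.
  apply: contra qp; rewrite subr_eq0 => /eqP qmp.
  have m2 : m ^+ 2 = 1.
    apply: (mulIf (x := dot p p)); first by rewrite gt_eqF.
    by rewrite mul1r -{2}qq qmp !dotE; ring.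
  have /orP[/eqP m1|/eqP mN1] : (m == 1) || (m == -1) by rewrite -eqf_sqr m2 expr1n.
    by rewrite qmp m1 scale1r.
  by move: m_gt0; rewrite mN1; lra.
have rE : r \in <<Phi>>%VS by rewrite rpredB ?rpredZ.
have neNAp : exists v, local_family dot Phi A p (- v).
  by have [v Av] := neAp; exists (- v); rewrite opprK.
have [eta0 [Aeta0 ANeta0]] := IH _ _ _ sz stl fixl fAp (opp_family fAp) neAp neNAp.
pose AA v := local_family dot Phi A p v /\ local_family dot Phi A p (- v).
(* The common direction [eta0] is projected to the span and, if necessary, pushed along r, without
   leaving its cell. *)
have [eta [[Aeta ANeta] etaE etar]] : exists eta,
    [/\ AA eta, eta \in <<Phi>>%VS & dot eta r != 0].
  have [w wE vw] := span_projection Phi eta0.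
  have weta b : b \in Phi -> dot w b = dot eta0 b.
    by move=> Pb; have /eqP := vw b Pb; rewrite dotDl dotNl subr_eq0 => /eqP.
  have wg : generic dot (localize dot Phi p) w.
    move=> b Pb; have := Pb; rewrite mem_localize => /andP[_ Pb'].
    by rewrite weta//; exact: (fam_gen fAp Aeta0).
  have loc v : (forall b, b \in localize dot Phi p -> 0 < dot w b * dot v b) -> AA v.
    move=> wv; have e0v b : b \in localize dot Phi p -> 0 < dot eta0 b * dot v b.
      move=> Pb; rewrite -weta; first exact: wv.
      by move: Pb; rewrite mem_localize => /andP[].
    split; first exact: (fam_sign fAp Aeta0).
    apply: (fam_sign fAp ANeta0) => b Pb; rewrite !dotNl mulrNN; exact: e0v.
  have [wr|wr] := eqVneq (dot w r) 0; last first.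
    by exists w; split=> //; apply: loc => b Pb; exact/sqr_gt0/wg.
  have [e e_gt0 se] := small_ex (small_sign dot (localize dot Phi p) w r).
  exists (w + e *: r); split.
  - by apply: loc => b Pb; apply: se => //; exact: wg.
  - by rewrite rpredD ?rpredZ.
  by rewrite dotDl dotZl wr add0r mulf_neq0 ?dot_eq0// gt_eqF.
(* First-order maximality of p along a direction leading into [A]; dividing by (p, p) normalizes the
   base point. *)
have closer xi : local_family dot Phi A p xi -> xi \in <<Phi>>%VS -> dot xi r <= 0.
  move=> Axi xiE; have sN : Num.sqrt (dot p p) != 0 by rewrite gt_eqF// sqrtr_gt0.
  have : dot xi q / dot p p <= m * (dot xi p / dot p p).
    apply: (@le_sqrt_small _ _ _ _ (dot xi xi / dot p p)).
    apply: small_sub (local_familyP fA Axi) => e e_gt0 Ae.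
    have xE : p + e *: xi \in <<Phi>>%VS by rewrite rpredD ?rpredZ.
    have cA : cell_closure Phi A (p + e *: xi).
      by exists (p + e *: xi) => // b _; rewrite -expr2 sqr_ge0.
    have := pmax _ xE cA; rewrite qq dotDl dotZl pq.
    rewrite -(ler_pM2r (_ : 0 < (dot p p)^-1)) ?invr_gt0//.
    have -> : (m * dot p p + e * dot xi q) / dot p p = m + e * (dot xi q / dot p p).
      by field; lra.
    set s := Num.sqrt (dot (_ + _) _).
    have -> : m * (s * Num.sqrt (dot p p)) / dot p p = m * (s / Num.sqrt (dot p p)).
      have tE := sqr_sqrtr (ltW pp); move: sN tE; set t := Num.sqrt (dot p p) => sN tE.
      by rewrite -tE; field.
    suff -> : s / Num.sqrt (dot p p) =
      Num.sqrt (1 + 2 * e * (dot xi p / dot p p) + e ^+ 2 * (dot xi xi / dot p p)) by [].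
    rewrite -sqrtrV ?(ltW pp)// -sqrtrM ?dot_ge0//; congr (Num.sqrt _).
    by rewrite !dotE [dot p xi]dotC; field; lra.
  rewrite mulrA ler_pM2r ?invr_gt0// /r dotDr dotNr dotZr; lra.
have h1 := closer _ Aeta etaE.
have etaNE : - eta \in <<Phi>>%VS by rewrite rpredN.
have := closer _ ANeta etaNE; rewrite dotNl oppr_le0 => h2.
by move: etar; rewrite eq_le h1 h2.
Qed.

End Meeting.

(** * Reflections, chambers and length *)

Section Words.
Variable X : coxeterSystem.
Implicit Types (w : X) (r : seq (cox_index X)).
Local Open Scope group_scope.

Lemma srefl_sq (i : cox_index X) : srefl i * srefl i = 1.
Proof. by have := expg_order (srefl i); rewrite (cox_order (coxP X)). Qed.

Lemma sreflV (i : cox_index X) : (srefl i)^-1 = srefl i.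
Proof. by apply: (mulgI (srefl i)); rewrite mulgV srefl_sq. Qed.

Lemma word_prod_nil : word_prod [::] = 1 :> X.
Proof. exact: big_nil. Qed.

Lemma word_prod_cons i r : word_prod (i :: r) = srefl i * word_prod r.
Proof. exact: big_cons. Qed.

Lemma word_prod_cat r r' : word_prod (r ++ r') = word_prod r * word_prod r'.
Proof. exact: big_cat. Qed.

Lemma word_prod_rcons r i : word_prod (rcons r i) = word_prod r * srefl i.
Proof. by rewrite -cats1 word_prod_cat word_prod_cons word_prod_nil mulg1. Qed.

Lemma word_prod_rev r : word_prod (rev r) = (word_prod r)^-1.
Proof.
elim: r => [|i r IH]; first by rewrite word_prod_nil invg1.
by rewrite rev_cons word_prod_rcons IH word_prod_cons invMg sreflV.
Qed.

Lemma cox_length_word r : (cox_length (word_prod r) <= size r)%N.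
Proof.
rewrite /cox_length; case: ex_minnP => m _; apply.
by apply/existsP; exists (in_tuple r).
Qed.

Lemma reduced_word w : exists2 r, size r = cox_length w & word_prod r = w.
Proof.
rewrite /cox_length; case: ex_minnP => m /existsP[t /eqP tw] _.
by exists t; rewrite ?size_tuple.
Qed.

End Words.

(** * Reflections, normals and separating hyperplanes *)

Section Chambers.
Variables (X : coxeterSystem) (D : diagramAut X).
Variables (R : realType) (V : vectType R) (dot : {dot V for idfun}).
Variable rho : twisted_group D -> 'End(V).
Hypothesis rho_rep : is_orthogonal_rep dot rho.
Local Notation act w := (rho (tw_of D w)).

Lemma tw_of1 : tw_of D 1%g = 1%g.
Proof. by apply: (mulgI (tw_of D 1%g)); rewrite -tw_ofM !mulg1. Qed.

Lemma tw_ofV w : tw_of D w^-1%g = ((tw_of D w)^-1)%g.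
Proof. by apply: (mulgI (tw_of D w)); rewrite -tw_ofM !mulgV tw_of1. Qed.

Lemma tw_conj_exists (h : twisted_group D) (w : X) :
  exists u, tw_of D u == (h * tw_of D w * h^-1)%g.
Proof.
have [k [x ->]] := tw_decomp h.
exists (iter k (dg_perm D) (x * w * x^-1)%g); apply/eqP.
elim: k => [|k IH]; first by rewrite expg0 mul1g !tw_ofM tw_ofV.
by rewrite /= -tw_deltaJ IH expgS !invMg !mulgA.
Qed.

(** Conjugation by h preserves the image of W. Read back in W, it permutes the reflections, which
    are indexed by elements of W. *)
Definition tw_conj h w := xchoose (tw_conj_exists h w).

Lemma tw_conjE h w : tw_of D (tw_conj h w) = (h * tw_of D w * h^-1)%g.
Proof. exact/eqP/(xchooseP (tw_conj_exists h w)). Qed.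

Lemma tw_conj_of x w : tw_conj (tw_of D x) w = (x * w * x^-1)%g.
Proof. by apply: (@tw_of_inj _ D); rewrite tw_conjE !tw_ofM tw_ofV. Qed.

Lemma tw_conjK h w : tw_conj h^-1%g (tw_conj h w) = w.
Proof.
by apply: (@tw_of_inj _ D); rewrite !tw_conjE invgK !mulgA mulVg mul1g mulgKV.
Qed.

Lemma tw_conj_inj h : injective (tw_conj h).
Proof. exact: can_inj (tw_conjK h). Qed.

Lemma rhoM h k v : rho (h * k)%g v = rho h (rho k v).
Proof. by rewrite (repM rho_rep) comp_lfunE. Qed.

Lemma rho1 v : rho 1%g v = v.
Proof. by rewrite (rep1 rho_rep) id_lfunE. Qed.

Lemma rhoK h v : rho h^-1%g (rho h v) = v.
Proof. by rewrite -rhoM mulVg rho1. Qed.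

Lemma rhoVK h v : rho h (rho h^-1%g v) = v.
Proof. by rewrite -rhoM mulgV rho1. Qed.

Lemma rho_adj h u v : dot (rho h u) v = dot u (rho h^-1%g v).
Proof. by rewrite -{1}(rhoVK h v) (rep_dot rho_rep). Qed.

Definition reflects_in (a : V) (w : X) :=
  dot a a = 1 /\ forall v, act w v = v - (2 * dot v a) *: a.

Definition reflections : {set X} := [set w | `[< is_reflection dot (act w) >]].

(** A unit normal with an arbitrary choice of sign; the value at elements that are not reflections
    is 0. *)
Definition mnormal w : V :=
  if pselect (exists a, reflects_in a w) is left h then sval (cid h) else 0.

Lemma mnormalP w : w \in reflections -> reflects_in (mnormal w) w.
Proof.
rewrite inE => /asboolP[a a0 wa]; rewrite /mnormal; case: pselect => [h|[]].
  by case: cid.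
have s := dot_sqrt_gt0 dot a0; have s2 := sqr_sqrtr (dot_ge0 dot a).
exists ((Num.sqrt (dot a a))^-1 *: a); move: s s2; set c := Num.sqrt _ => s s2.
split=> [|v]; first by rewrite !dotE -s2; field; lra.
rewrite wa scalerA; congr (_ - _ *: _).
by rewrite !dotE -s2; field; lra.
Qed.

Lemma reflects_in_refl a w : reflects_in a w -> w \in reflections.
Proof.
move=> [aa wa]; rewrite inE; apply/asboolP; exists a.
  by rewrite -(dot_eq0 dot) aa oner_eq0.
by move=> v; rewrite wa aa divr1.
Qed.

Lemma reflects_in_uniq a b w : reflects_in a w -> reflects_in b w ->
  a = b \/ a = - b.
Proof.
move=> [aa wa] [bb wb]; have := wa a; rewrite wb aa mulr1 => h.
have aE : a = dot a b *: b.
  apply: (scalerI (a := 2)); first by rewrite pnatr_eq0.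
  rewrite scalerA; move/eqP: h; rewrite -subr_eq0 addrAC opprB addrCA.
  rewrite subrr addr0 subr_eq0 => /eqP <- //.
have : dot a b ^+ 2 = 1.
  transitivity (dot (dot a b *: b) (dot a b *: b)); last by rewrite -aE.
  by rewrite !dotZl !dotZr bb; ring.
rewrite -[X in _ = X](expr1n _ 2) => /eqP; rewrite eqf_sqr => /orP[]/eqP ab.
  by left; rewrite aE ab scale1r.
by right; rewrite aE ab scaleN1r.
Qed.

Lemma reflects_in_inj a u w : reflects_in a u -> reflects_in a w -> u = w.
Proof.
move=> [_ ua] [_ wa]; apply: (@tw_of_inj _ D); apply: (rep_inj rho_rep).
by apply/lfunP => v; rewrite ua wa.
Qed.

Lemma reflects_inN a w : reflects_in a w -> reflects_in (- a) w.
Proof.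
move=> [aa wa]; split=> [|v]; first by rewrite !dotE aa opprK.
by rewrite wa dotNr mulrN scaleNr scalerN opprK.
Qed.

Lemma reflects_in_conj a w h : reflects_in a w -> reflects_in (rho h a) (tw_conj h w).
Proof.
move=> [aa wa]; split=> [|v]; first by rewrite (rep_dot rho_rep).
by rewrite tw_conjE !rhoM wa linearB linearZ /= rhoVK rho_adj invgK.
Qed.

Lemma tw_conj_refl h w : w \in reflections -> tw_conj h w \in reflections.
Proof. by move=> /mnormalP/(@reflects_in_conj _ _ h)/reflects_in_refl. Qed.

Lemma mnormal_conj h w : w \in reflections ->
  mnormal (tw_conj h w) = rho h (mnormal w) \/ mnormal (tw_conj h w) = - rho h (mnormal w).
Proof.
move=> wr; apply: (@reflects_in_uniq _ _ (tw_conj h w)).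
  exact/mnormalP/tw_conj_refl.
exact/reflects_in_conj/mnormalP.
Qed.

Lemma mnormal_neq0 w : w \in reflections -> mnormal w != 0.
Proof. by move=> /mnormalP[rr _]; rewrite -(dot_eq0 dot) rr oner_eq0. Qed.

(* The product of the two values is invariant although the unit normal of a
   conjugate reflection is only determined up to sign. *)
Lemma mnormal_conj_dot h w u v : w \in reflections ->
  dot (rho h u) (mnormal (tw_conj h w)) * dot (rho h v) (mnormal (tw_conj h w)) =
  dot u (mnormal w) * dot v (mnormal w).
Proof.
by move=> /(mnormal_conj h)[] ->; rewrite ?dotNr ?mulrNN !(rep_dot rho_rep).
Qed.

Definition offwalls v := forall t, t \in reflections -> dot v (mnormal t) != 0.

Definition samecell u v :=
  forall t, t \in reflections -> 0 < dot u (mnormal t) * dot v (mnormal t).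

Definition sepset u v :=
  [set t in reflections | dot u (mnormal t) * dot v (mnormal t) < 0].

Lemma mem_sepset u v t : (t \in sepset u v) =
  (t \in reflections) && (dot u (mnormal t) * dot v (mnormal t) < 0).
Proof. by rewrite [LHS]inE. Qed.

Lemma sepsetC u v : sepset u v = sepset v u.
Proof. by apply/setP => t; rewrite !mem_sepset mulrC. Qed.

Lemma samecellC u v : samecell u v -> samecell v u.
Proof. by move=> uv t /uv; rewrite mulrC. Qed.

Lemma samecell_trans u v w : samecell u v -> samecell v w -> samecell u w.
Proof. by move=> uv vw t tr; apply: mulr_gt0_trans (uv t tr) (vw t tr). Qed.

Lemma samecell_offwalls u v : samecell u v -> offwalls u.
Proof. by move=> uv t /uv/mulr_gt0_neq0[]. Qed.

Lemma offwalls_samecell u : offwalls u -> samecell u u.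
Proof. by move=> uw t /uw/sqr_gt0. Qed.

Lemma pull_refl h t : t \in reflections ->
  exists2 s, s \in reflections & t = tw_conj h s.
Proof.
move=> tr; exists (tw_conj h^-1%g t); first exact: tw_conj_refl.
by rewrite -{1}(invgK h) tw_conjK.
Qed.

Lemma samecell_act h u v : samecell u v -> samecell (rho h u) (rho h v).
Proof.
move=> uv t /(pull_refl h)[s sr ->]; rewrite mnormal_conj_dot//; exact: uv.
Qed.

Lemma offwalls_act h u : offwalls u -> offwalls (rho h u).
Proof.
by move=> /offwalls_samecell/(samecell_act h)/samecell_offwalls.
Qed.

Lemma sepset_act h u v : #|sepset (rho h u) (rho h v)| = #|sepset u v|.
Proof.
suff -> : sepset (rho h u) (rho h v) = tw_conj h @: sepset u v.
  by rewrite card_imset//; exact: tw_conj_inj.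
apply/setP => t; apply/idP/imsetP => [|[s]].
  rewrite mem_sepset => /andP[/(pull_refl h)[s sr ->]]; rewrite mnormal_conj_dot// => uv.
  by exists s; rewrite // mem_sepset sr.
by rewrite mem_sepset => /andP[sr uv] ->; rewrite mem_sepset tw_conj_refl//= mnormal_conj_dot.
Qed.

Lemma mulr_lt0_sign (x y z : R) : 0 < x * y -> (z * x < 0) = (z * y < 0).
Proof.
move=> xy; have [x0 y0] := mulr_gt0_neq0 xy.
have h u v : 0 < u * v -> z * u < 0 -> z * v < 0.
  move=> uv zu; have [v0|v0|v0] := ltrgt0P v; nra.
by apply/idP/idP; apply: h => //; rewrite mulrC.
Qed.

Lemma sepset_cell u v w : samecell u v -> sepset w u = sepset w v.
Proof.
move=> uv; apply/setP => t; rewrite !mem_sepset; case tr: (t \in reflections) => //=.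
exact: mulr_lt0_sign (uv t tr).
Qed.

Definition cross t u v := [/\ t \in reflections, dot u (mnormal t) * dot v (mnormal t) < 0 &
  forall s, s \in reflections -> s != t -> 0 < dot u (mnormal s) * dot v (mnormal s)].

Lemma cross_act h t u v : cross t u v -> cross (tw_conj h t) (rho h u) (rho h v).
Proof.
move=> [tr uvt uvs]; split; rewrite ?tw_conj_refl ?mnormal_conj_dot//.
move=> s /(pull_refl h)[s' s'r ->]; rewrite mnormal_conj_dot// => st.
by apply: uvs => //; apply: contra st => /eqP ->.
Qed.

Lemma sepset_cross t u v w : cross t u v -> offwalls w ->
  sepset w v = if t \in sepset w u then sepset w u :\ t else t |: sepset w u.
Proof.
move=> [tr uv st] ww; apply/setP => s; have wt := ww t tr.
have E : (s \in sepset w v) = if s == t then t \notin sepset w u else s \in sepset w u.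
  have [->|sNt] := eqVneq s t.
    rewrite !mem_sepset tr /= -leNgt.
    apply/idP/idP => [|h].
      by move: (dot w _) (dot u _) (dot v _) uv wt => a b c; nra.
    have {}h : 0 < dot w (mnormal t) * dot u (mnormal t).
      rewrite lt_neqAle h andbT eq_sym mulf_neq0//.
      by apply: contraTneq uv => ->; rewrite mul0r ltxx.
    by move: (dot w _) (dot u _) (dot v _) uv h => a b c; nra.
  rewrite !mem_sepset; case sr: (s \in reflections) => //=.
  by rewrite -(mulr_lt0_sign _ (st s sr sNt)).
rewrite E; have [->|sNt] := eqVneq s t.
  by case: ifPn => h; rewrite ?in_setD1 ?in_setU1 eqxx.
by case: ifPn => _; rewrite ?in_setD1 ?in_setU1 ?sNt ?(negPf sNt).
Qed.

Lemma sepset_crossr t u v w : cross t u v -> offwalls w ->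
  t \in sepset w u -> #|sepset w v|.+1 = #|sepset w u|.
Proof.
move=> tuv ww twu; rewrite (sepset_cross tuv ww) twu (cardsD1 t (sepset w u)) twu.
by rewrite add1n.
Qed.

Lemma sepset_crossN t u v w : cross t u v -> offwalls w ->
  t \notin sepset w u -> #|sepset w v| = #|sepset w u|.+1.
Proof.
by move=> tuv ww twu; rewrite (sepset_cross tuv ww) (negPf twu) cardsU1 twu.
Qed.

(** Replacing u by v toggles t in the separating set, and replacing [rho h u] by [rho h v] toggles
    [tw_conj h t]. Under each condition either some toggle is a removal or the two cancel. *)
Lemma cross_length h t u v : cross t u v -> offwalls u -> offwalls v ->
  [\/ dot u (mnormal t) * dot (rho h u) (mnormal t) < 0,
      dot u (mnormal t) * dot (rho h^-1%g u) (mnormal t) < 0 | tw_conj h t = t] ->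
  (#|sepset v (rho h v)| <= #|sepset u (rho h u)|)%N.
Proof.
move=> tuv uw vw cond; have hu := offwalls_act h uw.
have [tr _ _] := tuv; have tuv' := cross_act h tuv.
set S0 := sepset u (rho h u); set S1 := sepset v (rho h u).
have S1E : S1 = if t \in S0 then S0 :\ t else t |: S0.
  by rewrite /S1 sepsetC (sepset_cross tuv hu) sepsetC.
have S2E := sepset_cross tuv' vw; rewrite -/S1 in S2E.
have [tS0|tS0] := boolP (t \in S0).
  rewrite tS0 in S1E; rewrite S2E (cardsD1 t S0) tS0 -S1E.
  case: ifP => _; last by rewrite cardsU1 leq_add2r leq_b1.
  by rewrite (leq_trans (subset_leq_card (finset.subD1set _ _)))// leq_addl.
rewrite (negPf tS0) in S1E.
have [t1t|t1t] := eqVneq (tw_conj h t) t.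
  rewrite S2E t1t S1E setU11; apply: subset_leq_card; apply/fintype.subsetP => s.
  by rewrite in_setD1 in_setU1 => /andP[/negPf ->].
case: cond => [c|c|/eqP]; last by rewrite (negPf t1t).
  by move: tS0; rewrite mem_sepset tr c.
have t1S0 : tw_conj h t \in S0.
  rewrite mem_sepset tw_conj_refl//=.
  by rewrite -{1}(rhoVK h u) mnormal_conj_dot// mulrC.
have t1S1 : tw_conj h t \in S1 by rewrite S1E in_setU1 t1S0 orbT.
rewrite S2E t1S1 -ltnS.
have <- : #|S1| = #|S0|.+1 by rewrite S1E cardsU1 tS0.
by rewrite (cardsD1 (tw_conj h t) S1) t1S1.
Qed.

(** Choose w maximizing (w v, c): a reflection whose hyperplane separated w v from c would increase
    this inner product. *)
Lemma offwalls_transitive c v : offwalls c -> offwalls v ->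
  exists w : X, samecell c (act w v).
Proof.
move=> cw vw; have [w wmax] : exists w : X, forall u : X, dot (act u v) c <= dot (act w v) c.
  case: (@Order.TotalTheory.arg_maxP _ R X 1%g xpredT (fun w => dot (act w v) c) isT).
  by move=> w _ wmax; exists w => u; exact: wmax.
exists w => t tr; have wvw := offwalls_act (tw_of D w) vw.
rewrite ltNge le_eqVlt mulf_eq0 (negPf (cw t tr)) (negPf (wvw t tr)) /=.
apply/negP => neg; have := wmax (t * w)%g; rewrite leNgt => /negP; apply.
have [_ tE] := mnormalP tr; rewrite tw_ofM rhoM tE !dotE [dot (mnormal t) c]dotC.
by rewrite ltrBrDl; nra.
Qed.

End Chambers.

(** * The fundamental chamber as a sign cell *)

Section FundamentalChamber.
Variables (X : coxeterSystem) (D : diagramAut X).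
Variables (R : realType) (V : vectType R) (dot : {dot V for idfun}).
Variable rho : twisted_group D -> 'End(V).
Hypothesis rho_rep : is_orthogonal_rep dot rho.
Hypothesis rho_refl : forall i : cox_index X,
  is_reflection dot (rho (tw_of D (srefl i))).
Variable C : set (euclid V).
Hypothesis C_fund : fundamental_chamber dot rho C.
Local Notation act w := (rho (tw_of D w)).
Local Notation reflections := (reflections dot rho).
Local Notation mnormal := (mnormal dot rho).
Local Notation offwalls := (offwalls dot rho).
Local Notation samecell := (samecell dot rho).
Local Notation sepset := (sepset dot rho).
Local Notation cross := (cross dot rho).

Lemma mem_mirror t v : t \in reflections ->
  (v \in fixedSpace (act t)) = (dot v (mnormal t) == 0).
Proof.
move=> tr; have [_ tE] := mnormalP tr; apply/fixedSpaceP/eqP => [|v0]; last first.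
  by rewrite tE v0 mulr0 scale0r subr0.
rewrite tE => /eqP; rewrite -subr_eq0 addrAC subrr add0r oppr_eq0 scaler_eq0.
by rewrite (negPf (mnormal_neq0 tr)) orbF mulf_eq0 pnatr_eq0 /= => /eqP.
Qed.

Lemma hyperplane_complementE v : hyperplane_complement dot rho v <-> offwalls v.
Proof.
split=> [vC t tr|vw _ [t tr ->]].
  rewrite -mem_mirror//; apply: vC; exists t => //.
  by move: tr; rewrite inE => /asboolP.
have {}tr : t \in reflections by rewrite inE; exact/asboolP.
by rewrite mem_mirror//; exact: vw.
Qed.

Lemma segment_continuous (u v : V) :
  continuous (fun s : R => (u + s *: (v - u) : V) : euclid V).
Proof.
pose co (w : V) := passmx.rVof (vbasis {:V}) w.
have -> : (fun s : R => (u + s *: (v - u) : V) : euclid V) =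
    (passmx.vecof (vbasis {:V}) : _ -> euclid V) \o (fun s : R => co u + s *: co (v - u)).
  apply/funext => s /=; rewrite -[LHS](@rVof_vbasisK R V); congr (passmx.vecof _ _).
  by apply/rowP => i; rewrite !mxE linearD linearZ.
move=> s; apply: continuous_comp; last exact: vecof_vbasis_continuous.
apply: cvgD; first exact: cvg_cst.
by apply: cvgZr_tmp; exact: cvg_id.
Qed.

(** By intermediate values a connected subset of the complement cannot change sign on a normal;
    conversely, the segment between two points with equal signs avoids every hyperplane. *)
Lemma chamber_cell : exists2 c0, offwalls c0 & forall v, C v <-> samecell c0 v.
Proof.
have [[c0 /hyperplane_complementE cw CE] _ _] := C_fund.
exists c0 => // v; split=> [Cv t tr|c0v].
  rewrite ltNge; apply/negP => le0.
  have Cc0 : C c0.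
    by rewrite CE; apply: connected_component_refl; exact/hyperplane_complementE.
  have Csub u : C u -> offwalls u.
    by rewrite CE => /connected_component_sub/hyperplane_complementE.
  pose f : euclid V -> R := fun u => dot (u : V) (mnormal t).
  have fC : continuous f by exact: (@dotl_continuous _ _ dot idfun (mnormal t)).
  have /connected_intervalP If : connected (f @` C).
    apply: connected_continuous_connected; last exact: continuous_subspaceT.
    by rewrite CE; exact: component_connected.
  have [u Cu /eqP] : (f @` C) 0.
    have [c_gt0|c_lt0|c_0] := ltrgt0P (dot c0 (mnormal t)).
    - apply: (If (f v) (f c0)); [by exists v|by exists c0|].
      by apply/andP; split; rewrite /f; nra.
    - apply: (If (f c0) (f v)); [by exists c0|by exists v|].
      by apply/andP; split; rewrite /f; nra.
    by move: (cw t tr); rewrite c_0 eqxx.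
  by rewrite /f (negPf (Csub u Cu t tr)).
pose gam s : euclid V := (c0 + s *: (v - c0) : V).
have sub : gam @` `[0, 1] `<=` connected_component (hyperplane_complement dot rho) c0.
  apply: connected_component_max.
  - by exists 0; rewrite /gam ?scale0r ?addr0//= in_itv /= lexx ler01.
  - move=> _ [s /= s01 <-]; apply/hyperplane_complementE => t tr.
    move: s01; rewrite in_itv /= => /andP[s0 s1].
    have := c0v t tr; rewrite /gam !dotE => h.
    have c2 : 0 < dot c0 (mnormal t) * dot c0 (mnormal t) by exact/sqr_gt0/cw.
    have : 0 < dot c0 (mnormal t) * (dot c0 (mnormal t) + s * (dot v (mnormal t) - dot c0 (mnormal t))).
      move: (dot c0 _) (dot v _) h c2 => a b h c2.
      have -> : a * (a + s * (b - a)) = (1 - s) * (a * a) + s * (a * b) by ring.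
      have [->|s_neq0] := eqVneq s 0; first by lra.
      have s_gt0 : 0 < s by rewrite lt_neqAle eq_sym s_neq0.
      by apply: ltr_wpDl; [apply: mulr_ge0; [lra|exact: ltW]|exact: mulr_gt0].
    by case/mulr_gt0_neq0.
  apply: connected_continuous_connected; first exact: segment_connected.
  by apply: continuous_subspaceT; exact: segment_continuous.
rewrite CE; apply: sub; exists 1; first by rewrite /= in_itv /= lexx ler01.
by rewrite /gam scale1r addrCA subrr addr0.
Qed.

Lemma closure_chamber_sign c t x : C c -> t \in reflections -> closure C x ->
  0 <= dot (x : V) (mnormal t) * dot c (mnormal t).
Proof.
have [c0 _ CE] := chamber_cell; move=> Cc tr clx; rewrite leNgt; apply/negP => lt0.
have x0 : dot (x : V) (mnormal t) != 0.
  by apply: contraTneq lt0 => ->; rewrite mul0r ltxx.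
have [q [Cq xq]] := clx _ (near_dot_sign dot [:: mnormal t] x).
have {}xq := xq _ (mem_head _ _) x0.
have cq : 0 < dot (q : V) (mnormal t) * dot c (mnormal t).
  by apply: (samecell_trans (samecellC (_ : samecell c0 q)) _) => //; exact/CE.
by have := mulr_gt0_trans xq cq; rewrite ltNge ltW.
Qed.

Lemma srefl_reflection i : srefl i \in reflections.
Proof. by rewrite inE; apply/asboolP. Qed.

(** The component of one unit normal orthogonal to the other lies in both mirrors, which forces
    their inner product to be 1 or -1. *)
Lemma mirror_inj t u : t \in reflections -> u \in reflections ->
  (fixedSpace (act t) <= fixedSpace (act u))%VS -> t = u.
Proof.
move=> tr ur /subvP sub; have [tt tE] := mnormalP tr; have [uu uE] := mnormalP ur.
set a := dot (mnormal u) (mnormal t).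
have : mnormal u - a *: mnormal t \in fixedSpace (act t).
  by rewrite mem_mirror// !dotE tt -/a; apply/eqP; ring.
move=> /sub; rewrite mem_mirror// !dotE uu [dot (mnormal t) _]dotC -/a => /eqP a2.
have /eqP : a ^+ 2 = 1 ^+ 2 by lra.
have rr : dot (mnormal u - a *: mnormal t) (mnormal u - a *: mnormal t) = 1 - a ^+ 2.
  by rewrite !dotE uu tt [dot (mnormal t) _]dotC -/a; ring.
have uat : mnormal u = a *: mnormal t.
  by apply/eqP; rewrite -subr_eq0 -(dot_eq0 dot) rr; apply/eqP; lra.
rewrite eqf_sqr => /orP[]/eqP aE.
  apply: (reflects_in_inj rho_rep (mnormalP tr)).
  by have := mnormalP ur; rewrite uat aE scale1r.
apply: (reflects_in_inj rho_rep (mnormalP tr)).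
by have /(reflects_inN) := mnormalP ur; rewrite uat aE scaleN1r opprK.
Qed.

(* A wall of C is spanned by its intersection with the closure of C, on which
   any other hyperplane separating C from s_i C would vanish. *)
Lemma cross_simple i c : C c -> cross (srefl i) c (act (srefl i) c).
Proof.
have [c0 c0w CE] := chamber_cell; move=> Cc.
have sr := srefl_reflection i; have [rr sE] := mnormalP sr.
have cw : offwalls c by have /CE/samecellC/samecell_offwalls := Cc.
split=> // [|t tr tNs].
  rewrite sE !dotE rr; have := sqr_gt0 (cw _ sr); set x := dot c _.
  by rewrite (_ : x * _ = - (x * x)) ?oppr_lt0//; ring.
have scw := offwalls_act rho_rep (tw_of D (srefl i)) cw.
rewrite ltNge le_eqVlt mulf_eq0 (negPf (cw t tr)) (negPf (scw t tr)) /=.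
apply/negP => neg; move/eqP: tNs; apply; apply/esym.
apply: mirror_inj => //.
have [_ wallE _] := C_fund.
have [_ wl] : wall dot rho C (fixedSpace (act (srefl i))) by apply/wallE; exists i.
apply: wl => x xH clx; rewrite mem_mirror//.
have h1 := closure_chamber_sign Cc tr clx.
(* Since s_i fixes x, the sign condition for the conjugate of t by s_i is the one for t with s_i c
   in place of c. *)
have tr' := tw_conj_refl rho_rep (tw_of D (srefl i)) tr.
have h2 := closure_chamber_sign Cc tr' clx.
have sx : act (srefl i) x = x by exact/fixedSpaceP.
have ss : act (srefl i) (act (srefl i) c) = c.
  by rewrite -(rhoM rho_rep) -tw_ofM srefl_sq tw_of1 (rho1 rho_rep).
move: h2; rewrite -{1}sx -{1}ss mnormal_conj_dot// => h2.
apply: contraTT neg => y0; rewrite -leNgt -(pmulr_rge0 _ (sqr_gt0 y0)).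
by rewrite mulrACA mulr_ge0.
Qed.

End FundamentalChamber.

(** * Galleries *)

Section Galleries.
Variables (X : coxeterSystem) (D : diagramAut X).
Variables (R : realType) (V : vectType R) (dot : {dot V for idfun}).
Variable rho : twisted_group D -> 'End(V).
Hypothesis rho_rep : is_orthogonal_rep dot rho.
Local Notation act w := (rho (tw_of D w)).
Local Notation reflections := (reflections dot rho).
Local Notation mnormal := (mnormal dot rho).
Local Notation offwalls := (offwalls dot rho).
Local Notation samecell := (samecell dot rho).
Local Notation sepset := (sepset dot rho).
Local Notation cross := (cross dot rho).
Variable c0 : V.
Hypothesis c0w : offwalls c0.
Hypothesis cross_srefl : forall i c, samecell c0 c ->
  cross (srefl i) c (act (srefl i) c).
Hypothesis delta_cell : forall c, samecell c0 c -> samecell c0 (rho (tw_delta D) c).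

Lemma c0_cell : samecell c0 c0. Proof. exact: offwalls_samecell. Qed.

Definition inversions w := sepset c0 (act w c0).

Lemma inversions1 : inversions 1%g = finset.set0.
Proof.
apply/setP => t; rewrite mem_sepset finset.in_set0 tw_of1 (rho1 rho_rep).
by case tr: (t \in reflections) => //=; rewrite ltNge ltW// c0_cell.
Qed.

Lemma cross_chambers w i :
  cross (w * srefl i * w^-1)%g (act w c0) (act (w * srefl i)%g c0).
Proof.
rewrite tw_ofM (rhoM rho_rep) -(tw_conj_of D); apply: cross_act => //.
exact/cross_srefl/c0_cell.
Qed.

(* Strong exchange: delete the letter whose wall is the mirror of t. *)
Lemma inversion_shortens r t : t \in inversions (word_prod r) ->
  (cox_length (t * word_prod r)%g < size r)%N.
Proof.
move=> tr; suff [r' sr' <-] : exists2 r', (size r' < size r)%N &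
    word_prod r' = (t * word_prod r)%g.
  exact: leq_ltn_trans (cox_length_word r') sr'.
elim/last_ind: r tr => [|r i IH]; first by rewrite word_prod_nil inversions1 finset.in_set0.
rewrite word_prod_rcons size_rcons.
set w := word_prod r in IH *; rewrite /inversions (sepset_cross (cross_chambers w i) c0w).
have step : t \in inversions w -> exists2 r', (size r' < (size r).+1)%N &
    word_prod r' = (t * (w * srefl i))%g.
  move=> /IH[r' sr' tw]; exists (rcons r' i); first by rewrite size_rcons ltnS.
  by rewrite word_prod_rcons tw mulgA.
case: ifP => _; first by rewrite in_setD1 => /andP[_]; exact: step.
rewrite in_setU1 => /orP[/eqP ->|]; last exact: step.
(* The deleted letter is the last one: t = w s_i w^-1 sends w s_i to w. *)
exists r => //; rewrite -/w !mulgA mulgKV.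
by rewrite -mulgA srefl_sq mulg1.
Qed.

(** If the last letter of a reduced word added no new wall, w s_i w^-1 would be an inversion of w,
    and w s_i would be shorter than w. *)
Lemma card_inversions r : size r = cox_length (word_prod r) ->
  #|inversions (word_prod r)| = size r.
Proof.
elim/last_ind: r => [|r i IH]; first by rewrite word_prod_nil inversions1 cards0.
rewrite size_rcons => sr.
have srE : size r = cox_length (word_prod r).
  apply/eqP; rewrite eqn_leq cox_length_word andbT -ltnS sr word_prod_rcons.
  have [r' <- r'E] := reduced_word (word_prod r).
  by rewrite -r'E -word_prod_rcons (leq_trans (cox_length_word _))// size_rcons.
rewrite word_prod_rcons; set w := word_prod r in IH srE sr *.
rewrite -(IH srE) /inversions (sepset_crossN (cross_chambers w i) c0w)//.
apply/negP => /inversion_shortens; rewrite -/w mulgKV -word_prod_rcons -sr.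
by rewrite ltnNge leqnSn.
Qed.

Lemma cox_length_card w : cox_length w = #|inversions w|.
Proof. by have [r sr rw] := reduced_word w; rewrite -sr -rw card_inversions ?rw. Qed.

(** Powers of delta preserve the chamber of [c0] and the number of separating hyperplanes, so only
    the W-part counts. *)
Lemma tw_length_sepset h : tw_length h = #|sepset c0 (rho h c0)|.
Proof.
have [k [w ->]] := tw_decomp h; rewrite tw_length_delta cox_length_card.
have dk n : samecell c0 (rho (tw_delta D ^+ n)%g c0).
  elim: n => [|n IH]; first by rewrite expg0 (rho1 rho_rep); exact: c0_cell.
  by rewrite expgS (rhoM rho_rep); exact: delta_cell.
rewrite sepsetC (sepset_cell _ (dk k)) sepsetC (rhoM rho_rep) sepset_act//.
Qed.

Definition in_chamber y v := samecell c0 (act y^-1%g v).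

Lemma in_chamberE y v : in_chamber y v <-> samecell (act y c0) v.
Proof.
split=> [/(samecell_act rho_rep (tw_of D y))|/(samecell_act rho_rep (tw_of D y^-1%g))].
  by rewrite tw_ofV (rhoVK rho_rep).
by rewrite /in_chamber tw_ofV (rhoK rho_rep).
Qed.

Lemma in_chamber_offwalls y v : in_chamber y v -> offwalls v.
Proof. by move=> /in_chamberE/samecellC/samecell_offwalls. Qed.

Definition tw_twist (g : twisted_group D) (y : X) : twisted_group D :=
  ((tw_of D y)^-1 * g * tw_of D y)%g.

Lemma tw_twistM g x y : tw_twist g (x * y)%g = tw_twist (tw_twist g x) y.
Proof. by rewrite /tw_twist tw_ofM invMg !mulgA. Qed.

(** Translation by y carries the chambers C and y^-1 g y C to y C and g y C. *)
Lemma tw_length_chamber g y v : in_chamber y v ->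
  tw_length (tw_twist g y) = #|sepset v (rho g v)|.
Proof.
move=> /in_chamberE yv; rewrite tw_length_sepset /tw_twist.
rewrite -(sepset_act rho_rep (tw_of D y)) -(rhoM rho_rep) !mulgA mulgV mul1g (rhoM rho_rep).
rewrite (sepset_cell _ (samecell_act rho_rep g yv)) sepsetC (sepset_cell _ yv).
by rewrite sepsetC.
Qed.

Lemma in_chamber_exists v : offwalls v -> exists y, in_chamber y v.
Proof.
move=> vw; have [w cw] := offwalls_transitive rho_rep c0w vw.
by exists w^-1%g; rewrite /in_chamber invgK.
Qed.

Lemma in_chamber_step y v i : in_chamber y v ->
  exists t v', [/\ in_chamber (y * srefl i)%g v', cross t v v' & t = (y * srefl i * y^-1)%g].
Proof.
move=> yv; set v' := act (y * srefl i * y^-1)%g v.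
have v'E : v' = act y (act (srefl i) (act y^-1%g v)).
  by rewrite /v' !tw_ofM !(rhoM rho_rep).
exists (y * srefl i * y^-1)%g, v'; split=> //; last first.
  have := cross_act rho_rep (tw_of D y) (cross_srefl i yv).
  by rewrite tw_conj_of -v'E tw_ofV (rhoVK rho_rep).
apply/in_chamberE; rewrite v'E tw_ofM (rhoM rho_rep).
by do 2 apply: (samecell_act rho_rep); exact: yv.
Qed.

(** Take the first letter of a reduced word for y^-1 y': if its wall did not separate, prepending it
    would lengthen the word it in fact shortens. *)
Lemma chamber_descent y y' v v' : in_chamber y v -> in_chamber y' v' -> y != y' ->
  exists i, (y * srefl i * y^-1)%g \in sepset v v'.
Proof.
move=> /in_chamberE yv /in_chamberE yv' yy'; set w := (y^-1 * y')%g.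
have [r sr rw] := reduced_word w; case: r => [|i r] in sr rw.
  by move: rw yy'; rewrite word_prod_nil => /esym/eqP; rewrite -eq_mulVg1 => /eqP->; rewrite eqxx.
exists i; rewrite -(tw_conj_of D).
have [tr st _] := cross_srefl i c0_cell.
suff iw : srefl i \in sepset c0 (act w c0).
  rewrite sepsetC -(sepset_cell _ yv) sepsetC -(sepset_cell _ yv').
  have -> : act y' c0 = act y (act w c0).
    by rewrite -(rhoM rho_rep) -tw_ofM /w mulKVg.
  move: iw; rewrite !mem_sepset => /andP[_ iw].
  by rewrite tw_conj_refl//= mnormal_conj_dot.
apply: contraT => iwN.
have ww : offwalls (act w c0) by exact: offwalls_act.
have iwN' : srefl i \notin sepset (act w c0) c0 by rewrite sepsetC.
have := sepset_crossN (cross_srefl i c0_cell) ww iwN'.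
rewrite [sepset _ c0]sepsetC -/(inversions w) -cox_length_card.
have -> : #|sepset (act w c0) (act (srefl i) c0)| = cox_length (srefl i * w)%g.
  rewrite cox_length_card /inversions -(sepset_act rho_rep (tw_of D (srefl i))) sepsetC.
  by rewrite -!(rhoM rho_rep) -!tw_ofM srefl_sq tw_of1 (rho1 rho_rep).
have le : (cox_length (srefl i * w) <= size r)%N.
  by rewrite -rw word_prod_cons mulgA srefl_sq mul1g cox_length_word.
by move=> E; move: le; rewrite E -sr /= ltnNge leqnSn.
Qed.

Lemma in_chamber_uniq y y' v : in_chamber y v -> in_chamber y' v -> y = y'.
Proof.
move=> yv yv'; apply/eqP; apply: contraT => /(chamber_descent yv yv')[i].
have vw := in_chamber_offwalls yv.
rewrite mem_sepset => /andP[tr]; rewrite ltNge ltW//; exact/sqr_gt0/vw.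
Qed.

Lemma tw_twist_srefl (h : twisted_group D) (i : cox_index X) :
  (tw_of D (srefl i) * h * tw_of D (srefl i))%g = tw_twist h (srefl i).
Proof. by rewrite /tw_twist -tw_ofV sreflV. Qed.

Lemma tw_twist1 (h : twisted_group D) : tw_twist h 1%g = h.
Proof. by rewrite /tw_twist tw_of1 invg1 mul1g mulg1. Qed.

Lemma weak_descent_cat (h : twisted_group D) r r' : weak_descent h (r ++ r') =
  weak_descent h r && weak_descent (tw_twist h (word_prod r)) r'.
Proof.
elim: r h => [|i r IH] h /=; first by rewrite word_prod_nil tw_twist1.
by rewrite tw_twist_srefl IH word_prod_cons tw_twistM andbA.
Qed.

Lemma weak_descent_rcons (h : twisted_group D) r i : weak_descent h (rcons r i) =
  weak_descent h r &&
  (tw_length (tw_twist h (word_prod (rcons r i))) <= tw_length (tw_twist h (word_prod r)))%N.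
Proof.
by rewrite -{1}cats1 weak_descent_cat /= andbT tw_twist_srefl -tw_twistM word_prod_rcons.
Qed.

Lemma weak_descent_length (h : twisted_group D) r : weak_descent h r ->
  (tw_length (tw_twist h (word_prod r)) <= tw_length h)%N.
Proof.
elim/last_ind: r => [|r i IH]; first by rewrite word_prod_nil tw_twist1.
by rewrite weak_descent_rcons => /andP[/IH le1 le2]; exact: leq_trans le2 le1.
Qed.

(** Starting from minimal length, no step can strictly decrease the length, so every step may be
    reversed. *)
Lemma weak_descent_rev (h : twisted_group D) r : weak_descent h r ->
  (forall y, tw_length h <= tw_length (tw_twist h y))%N ->
  weak_descent (tw_twist h (word_prod r)) (rev r).
Proof.
move=> + hmin; elim/last_ind: r => [|r i IH] //.
rewrite weak_descent_rcons rev_rcons => /andP[hr _] /=.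
rewrite tw_twist_srefl -tw_twistM word_prod_rcons -mulgA srefl_sq mulg1 IH// andbT.
exact: leq_trans (weak_descent_length hr) (hmin _).
Qed.

(** Both signs are listed, so that the whole group permutes the list in spite of the sign choice in
    [mnormal]. *)
Definition normals : seq V :=
  [seq mnormal t | t <- enum reflections] ++ [seq - mnormal t | t <- enum reflections].

Lemma normalsP a : a \in normals <->
  exists2 t, t \in reflections & a = mnormal t \/ a = - mnormal t.
Proof.
rewrite mem_cat; split=> [/orP[] /mapP[t]|[t tr ta]].
- by rewrite mem_enum => tr ->; exists t => //; left.
- by rewrite mem_enum => tr ->; exists t => //; right.
by apply/orP; case: ta => ->; [left|right]; apply/mapP; exists t; rewrite ?mem_enum.
Qed.

Lemma normals_act h a : a \in normals -> rho h a \in normals.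
Proof.
move=> /normalsP[t tr ta]; apply/normalsP.
exists (tw_conj h t); first exact: tw_conj_refl.
by case: (mnormal_conj rho_rep h tr) => ->; case: ta => ->;
  rewrite ?linearN ?opprK; auto.
Qed.

Lemma generic_normals v : generic dot normals v <-> offwalls v.
Proof.
split=> [vg t tr|vw a /normalsP[t tr [] ->]].
- by apply: vg; apply/normalsP; exists t => //; left.
- exact: vw.
by rewrite dotNr oppr_eq0 vw.
Qed.

(* x and y stand for the chambers x C and y C. *)
Definition reach g x y :=
  exists2 r, weak_descent (tw_twist g x) r & y = (x * word_prod r)%g.

Definition reach_cells g x v := exists2 y, reach g x y & in_chamber y v.

Lemma reach_step g x y i : reach g x y ->
  (tw_length (tw_twist g (y * srefl i)%g) <= tw_length (tw_twist g y))%N ->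
  reach g x (y * srefl i)%g.
Proof.
move=> [r gr yE] le; exists (rcons r i); last by rewrite word_prod_rcons yE mulgA.
by rewrite weak_descent_rcons gr -!tw_twistM word_prod_rcons mulgA -yE.
Qed.

(* Induction on the number of walls separating v from v': the first wall of a
   minimal gallery between them is crossed without increasing the length, and
   p keeps lying in the closures of the chambers along the gallery. *)
Lemma reach_flow_family g x :
  flow_family dot (rho g) (rho g^-1%g) normals (reach_cells g x).
Proof.
split=> [v [y _ /in_chamber_offwalls/generic_normals]//|p v v' [y xy yv] v'g].
have v'w : offwalls v' by exact/generic_normals.
have [n] := ubnP #|sepset v v'|; elim: n v y xy yv => // n IH v y xy yv szn sgp sgv.
have vw := in_chamber_offwalls yv.
have [y' yv'] := in_chamber_exists v'w.
have [yy'|yy'] := eqVneq y y'; first by exists y => //; rewrite yy'.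
have [i tv] := chamber_descent yv yv' yy'.
have [t [v1 [yv1 tvv1 tE]]] := in_chamber_step i yv; rewrite -tE in tv.
have tv' : t \in sepset v' v by rewrite sepsetC.
move: (tv); rewrite mem_sepset => /andP[tr tvv'].
have an : mnormal t \in normals by apply/normalsP; exists t => //; left.
have v1w := in_chamber_offwalls yv1.
(* As p lies in the closure of the cell of v, [rho h p] and [rho h v] have the same sign on the
   normal of t, while v and v' have opposite signs there. *)
have actv h : 0 < dot v' (mnormal t) * dot (rho h p) (mnormal t) ->
    dot v (mnormal t) * dot (rho h v) (mnormal t) < 0.
  move=> v'p; have [_ hp0] := mulr_gt0_neq0 v'p.
  have bn := normals_act h^-1%g an.
  rewrite (rho_adj rho_rep) in hp0; have [h1 _] := sgp _ bn hp0.
  rewrite -!(rho_adj rho_rep) in h1; have h2 := mulr_gt0_trans v'p h1.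
  by rewrite -(mulr_lt0_sign _ h2).
have le : (#|sepset v1 (rho g v1)| <= #|sepset v (rho g v)|)%N.
  apply: (cross_length rho_rep tvv1 vw v1w).
  case: (sgv _ an tvv') => [/actv|/actv|gN]; [by constructor 1|by constructor 2|].
  (* If g negates the normal of t, then conjugation by g fixes the reflection t. *)
  constructor 3; apply: (reflects_in_inj rho_rep (mnormalP (tw_conj_refl rho_rep g tr))).
  case: (mnormal_conj rho_rep g tr) => ->; rewrite gN ?opprK; last exact: mnormalP.
  exact/reflects_inN/mnormalP.
rewrite -!(tw_length_chamber _ yv, tw_length_chamber _ yv1) in le.
have [_ tneg tpos] := tvv1.
have same b : b \in normals -> b != mnormal t -> b != - mnormal t ->
    0 < dot v b * dot v1 b.
  move=> /normalsP[s sr [] ->].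
    by move=> st _; apply: tpos => //; apply: contra st => /eqP ->.
  rewrite eqr_opp !dotNr mulrNN => _ st.
  by apply: tpos => //; apply: contra st => /eqP ->.
have tpos1 : 0 < dot v1 (mnormal t) * dot v' (mnormal t).
  by move: tneg tvv'; move: (dot v _) (dot v1 _) (dot v' _) => a b c; nra.
apply: (IH v1 _ (reach_step xy le) yv1).
- rewrite sepsetC; rewrite sepsetC in szn.
  by rewrite -ltnS (sepset_crossr tvv1 v'w tv').
- move=> b bn pb; have [h1 h2] := sgp b bn pb; split=> //.
  have vv' : 0 < dot v b * dot v' b by apply: (mulr_gt0_trans _ h2); rewrite mulrC.
  apply: (mulr_gt0_trans h1); apply: same => //.
    by apply: contraTneq vv' => ->; rewrite -leNgt ltW.
  by apply: contraTneq vv' => ->; rewrite !dotNr mulrNN -leNgt ltW.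
move=> b bn v1v'; apply: sgv => //.
rewrite mulrC -(mulr_lt0_sign _ (_ : 0 < dot v1 b * dot v b)); first by rewrite mulrC.
rewrite mulrC; apply: same => //.
  by apply: contraTneq v1v' => ->; rewrite -leNgt ltW.
by apply: contraTneq v1v' => ->; rewrite !dotNr mulrNN -leNgt ltW.
Qed.

Lemma reach_common g x x' :
  (forall v, rho g v = v -> forall a, a \in normals -> dot v a = 0) ->
  exists2 y, reach g x y & reach g x' y.
Proof.
move=> gfix.
have self z : exists v, reach_cells g z v.
  exists (act z c0); exists z.
    by exists [::]; rewrite // word_prod_nil mulg1.
  by apply/in_chamberE; apply: (samecell_act rho_rep); exact: c0_cell.
have st : stable_roots (rho g) (rho g^-1%g) normals.
  by move=> a an; split; exact: normals_act.
have [v [[y xy yv] [y' xy' yv']]] := flow_families_meet (rhoK rho_rep g)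
  (rhoVK rho_rep g) (rep_dot rho_rep g) st gfix (reach_flow_family g x)
  (reach_flow_family g x') (self x) (self x').
by exists y => //; rewrite (in_chamber_uniq yv yv').
Qed.

(** The path from 1 to a common chamber y is followed by the reverse of the path from x to y, which
    is allowed because the conjugate of g by x is also of minimal length. *)
Lemma weak_descent_surj (g : twisted_group D) x :
  (forall v, rho g v = v -> forall a, a \in normals -> dot v a = 0) ->
  (forall y, tw_length g <= tw_length (tw_twist g y))%N ->
  tw_length (tw_twist g x) = tw_length g ->
  exists2 r, weak_descent g r & word_prod r = x.
Proof.
move=> gfix gmin gx; have [y [r1 gr1 yE1] [r2 gr2 yE2]] := reach_common 1%g x gfix.
rewrite tw_twist1 in gr1; rewrite mul1g in yE1.
exists (r1 ++ rev r2); last by rewrite word_prod_cat word_prod_rev -yE1 yE2 mulgK.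
rewrite weak_descent_cat gr1 -yE1 yE2 tw_twistM weak_descent_rev// => z.
by rewrite gx -tw_twistM.
Qed.

End Galleries.

(* Conclusion for an elliptic conjugacy class *)
Local Close Scope classical_set_scope.
Local Close Scope ring_scope.

Theorem theorem4p2 (X : coxeterSystem) (D : diagramAut X)
  (R : realType) (V : vectType R) (dot : {dot V for idfun}%R)
  (rho : twisted_group D -> 'End(V)%VF)
  (rho_rep : is_orthogonal_rep dot rho)
  (rho_refl : forall i : cox_index X,
     is_reflection dot (rho (tw_of D (srefl i))))
  (C : set (euclid V)) (C_fund : fundamental_chamber dot rho C)
  (O : {set twisted_group D})
  (O_class : O \in classes [set: twisted_group D]%g)
  (O_ell : elliptic rho O)
  (g : twisted_group D) (g_min : g \in min_elements O) :
  set_fun (path_set g) (length_stabilizer g) (@word_prod X) /\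
  set_surj (path_set g) (length_stabilizer g) (@word_prod X).
Proof.
have [c0 c0w CE] := chamber_cell C_fund.
have crossC i c : samecell dot rho c0 c ->
    cross dot rho (srefl i) c (rho (tw_of D (srefl i)) c).
  by move=> /CE; exact: (cross_simple rho_rep rho_refl C_fund).
have deltaC c : samecell dot rho c0 c -> samecell dot rho c0 (rho (tw_delta D) c).
  by move=> /CE Cc; apply/CE; have [_ _ <-] := C_fund; exists c.
move: g_min; rewrite finset.inE => /andP[gO /forallP gmin].
have /imsetP[k _ OE] := O_class.
have conjO h y : h \in O -> (h ^ y)%g \in O.
  rewrite OE => /imsetP[x _ ->]; apply/imsetP.
  by exists (x * y)%g; rewrite ?finset.inE ?conjgM.
have minO y : (tw_length g <= tw_length (tw_twist g y))%N.
  have := gmin (tw_twist g y); rewrite /tw_twist -mulgA -conjgE.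
  by rewrite conjO.
split=> [r /= gr|w /= gw].
  apply/eqP; rewrite eqn_leq minO andbT; exact: weak_descent_length.
have gfix v : rho g v = v -> forall a, a \in normals dot rho -> dot v a = 0%R.
  (* Ellipticity is given for some h in the class; conjugating h to g carries its fixed vectors to
     those of g. *)
  move=> gv; have [h hO /subvP hfix] := O_ell.
  have [x gE] : exists x, h = (g ^ x)%g.
    move: hO gO; rewrite OE => /imsetP[x _ ->] /imsetP[y _ ->].
    by exists (y^-1 * x)%g; rewrite -conjgM mulKVg.
  have : rho x^-1%g v \in fixedSpace (rho h).
    apply/fixedSpaceP; rewrite gE conjgE !(rhoM rho_rep) (rhoVK rho_rep) gv //.
  move=> /hfix xv a /normalsP[t tr ta].
  (* The translate of v is fixed by all of W, in particular by the corresponding conjugate of t, so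
     t fixes v. *)
  have tv : rho (tw_of D t) v = v.
    have /fixedSpaceP : rho x^-1%g v \in fixedSpace (rho (tw_of D (tw_conj x^-1%g t))).
      by move: xv; rewrite /fixed_by_W memvE => /subv_bigcapP h'; rewrite memvE; exact: h'.
    rewrite tw_conjE !(rhoM rho_rep) invgK (rhoVK rho_rep) => /(can_inj (rhoK rho_rep x^-1%g)).
    by [].
  have vt : dot v (mnormal dot rho t) = 0%R.
    by apply/eqP; rewrite -(mem_mirror v tr); exact/fixedSpaceP.
  by case: ta => ->; rewrite ?dotNr vt ?oppr0.
have [r gr rw] := weak_descent_surj rho_rep c0w crossC deltaC gfix minO gw.
by exists r.
Qed.
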